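(* Let $\mathcal{A}=\mathcal{A}_n^{\bar q,\Lambda}(\mathbb{K})$ and suppose $q_1^{i_1}\cdots q_n^{i_n}=1$ ($i_k\in\mathbb{Z}$) implies $i_1=\cdots=i_n=0$. (1) For every $\mathbb{K}$-algebra automorphism $\varphi$ of $\mathcal{A}_{\mathcal{Z}}$ there exist a partition $\{1,\dots,n\}=P_1\cup P_2$, integers $c_k$ ($1\le k\le n$), integers $a_{ij}$ and $b_{ji}$ ($i\in P_1$, $j\in P_2$), and scalars $\alpha_k,\beta_k\in\mathbb{K}^*$ ($1\le k\le n$) such that for $i\in P_1$: $\varphi(x_i)=\alpha_i\big(\prod_{j\in P_2}z_j^{a_{ij}}\big)z_i^{c_i}x_i$, $\varphi(y_i)=\beta_i\big(\prod_{j\in P_2}z_j^{-a_{ij}}\big)z_i^{-c_i}y_i$, with $\alpha_i\beta_i=q_i^{c_i}$; for $j\in P_2$: $\varphi(x_j)=\alpha_j\big(\prod_{i\in P_1}z_i^{b_{ji}}\big)z_j^{c_j}y_j$, $\varphi(y_j)=\beta_j\big(\prod_{i\in P_1}z_i^{-b_{ji}}\big)z_j^{-c_j-1}x_j$, with $\alpha_j\beta_j=-q_j^{-c_j-1}$; and $q_i^{b_{ji}}q_j^{a_{ij}}=\lambda_{ij}^2$ for all $i\in P_1$, $j\in P_2$. (2) Conversely, for any partition $P_1\cup P_2$ and any integers and scalars satisfying these conditions, the formulas above extend to a $\mathbb{K}$-algebra automorphism of $\mathcal{A}_{\mathcal{Z}}$.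
   Context: Let $\mathbb{K}$ be a field, $n\ge 1$, $\bar q=(q_1,\dots,q_n)\in(\mathbb{K}^* )^n$, and $\Lambda=(\lambda_{ij})$ an $n\times n$ matrix over $\mathbb{K}^*$ with $\lambda_{ij}=\lambda_{ji}^{-1}$, $\lambda_{ii}=1$. $\mathcal{A}_n^{\bar q,\Lambda}(\mathbb{K})$ is the $\mathbb{K}$-algebra generated by $x_1,y_1,\dots,x_n,y_n$ with relations: for $1\le i<j\le n$, $x_ix_j=\lambda_{ij}x_jx_i$, $y_jy_i=\lambda_{ji}y_iy_j$, $x_iy_j=\lambda_{ji}y_jx_i$, $x_jy_i=\lambda_{ij}y_ix_j$; and $x_iy_i-q_iy_ix_i=1$ for all $i$. Put $z_i=x_iy_i-y_ix_i$; these are pairwise commuting normal elements ($z_iy_i=q_iy_iz_i$, $z_ix_i=q_i^{-1}x_iz_i$, $z_i$ commutes with $x_j,y_j$ for $j\ne i$). $\mathcal{Z}$ is the multiplicative submonoid generated by $z_1,\dots,z_n$ (an Ore set) and $\mathcal{A}_{\mathcal{Z}}$ the localization of $\mathcal{A}$ at $\mathcal{Z}$, in which the $z_i$ are invertible. *)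

(* Defs.v *)
From HB Require Import structures.
From mathcomp Require Import all_boot all_order all_algebra.
Set Implicit Arguments. Unset Strict Implicit. Unset Printing Implicit Defensive.
Import Order.TTheory GRing.Theory Num.Theory.
Local Open Scope ring_scope.

Definition qweyl_rel (K : fieldType) (n : nat) (q : 'I_n -> K)
    (lam : 'I_n -> 'I_n -> K) (R : algType K) (X Y : 'I_n -> R) : Prop :=
  (forall i j : 'I_n, (i < j)%N ->
     [/\ X i * X j = lam i j *: (X j * X i),
         Y j * Y i = lam j i *: (Y i * Y j),
         X i * Y j = lam j i *: (Y j * X i)
       & X j * Y i = lam i j *: (Y i * X j)]) /\
  (forall i : 'I_n, X i * Y i - q i *: (Y i * X i) = 1).

Definition zel (R : nzRingType) (n : nat) (X Y : 'I_n -> R) (i : 'I_n) : R :=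
  X i * Y i - Y i * X i.

Definition two_sided_unit (R : nzRingType) (a : R) : Prop :=
  exists b : R, a * b = 1 /\ b * a = 1.

Definition alg_hom (K : fieldType) (A R : algType K) (f : A -> R) : Prop :=
  [/\ forall a b, f (a + b) = f a + f b,
      forall (k : K) a, f (k *: a) = k *: f a,
      forall a b, f (a * b) = f a * f b
    & f 1 = 1].

Definition alg_aut (K : fieldType) (A : algType K) (f : A -> A) : Prop :=
  alg_hom f /\ bijective f.

(* (B, x, y) is the localization A_Z of A_n^{q,Lambda}(K) at the Ore set
   generated by the z_i, characterized by its universal property: the
   K-algebra generated by x_i, y_i subject to the defining relations in which
   the z_i are invertible (universal among such). *)
Definition is_loc_qweyl (K : fieldType) (n : nat) (q : 'I_n -> K)
    (lam : 'I_n -> 'I_n -> K) (B : unitAlgType K) (x y : 'I_n -> B) : Prop :=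
  [/\ qweyl_rel q lam x y,
      (forall i, zel x y i \is a GRing.unit),
      (forall (R : algType K) (X Y : 'I_n -> R),
          qweyl_rel q lam X Y -> (forall i, two_sided_unit (zel X Y i)) ->
          exists f : B -> R, alg_hom f /\ (forall i, f (x i) = X i /\ f (y i) = Y i))
    & (forall (R : algType K) (f g : B -> R), alg_hom f -> alg_hom g ->
          (forall i, f (x i) = g (x i) /\ f (y i) = g (y i)) -> f =1 g)].

(* Main.v *)
(* Write z^a for the Laurent monomials in the z_i, L for their span, and give b
   weight d when b z_j = q_j^(d_j) z_j b for all j. No model of A_Z is needed.
   Since the q_i are independent, weight spaces are automatically in direct sum.
   The monomials z^a are linearly independent because A_Z <> 0: a relation splits
   into parts that are eigenvectors for x_i and y_i, and such a part f satisfies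
   f x_i^N = 0 = f y_i^M, hence is killed by two coprime polynomials in z_i.
   The universal property gives A_Z = sum of the L V_d, V_d being the monomial
   of weight d in the x_i, y_i. Leading terms for a lexicographic order show that
   A_Z is a domain whose units are weight vectors, and then that they are
   scalar multiples of the z^a, since k z_i - 1 is not invertible.
   An automorphism phi thus sends z_i to a multiple of some z^(m_i), so phi(x_i) is
   again a weight vector; independence of the q_i forces m_i = +-e_i and
   phi(x_i) in L x_i or L y_i. As x_i y_i and y_i x_i are affine in z_i, the
   coefficients are units of L, and the relations determine the exponents. *)
Require Import Defs.
From HB Require Import structures.
From mathcomp Require Import all_boot all_order all_algebra.
From mathcomp Require Import boolp ring.
Set Implicit Arguments. Unset Strict Implicit. Unset Printing Implicit Defensive.
Import Order.TTheory GRing.Theory Num.Theory.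
Local Open Scope ring_scope.

(** * Subalgebras cut out by a closed predicate *)

Section Subalgebra.
Variables (K : fieldType) (A : algType K) (P : A -> Prop).
Hypotheses (P1 : P 1) (PL : forall (k : K) a b, P a -> P b -> P (k *: a + b)).
Hypothesis PM : forall a b, P a -> P b -> P (a * b).

Definition subalg_pred : {pred A} := fun a => `[< P a >].

Fact subalg_pred_closed : subalg_closed subalg_pred.
Proof.
split; first exact/asboolP.
- by move=> k a b /asboolP Pa /asboolP Pb; apply/asboolP/PL.
- by move=> a b /asboolP Pa /asboolP Pb; apply/asboolP/PM.
Qed.

HB.instance Definition _ :=
  GRing.isSubalgClosed.Build K A subalg_pred subalg_pred_closed.

Record subalg := Subalg { subalg_val : A; _ : subalg_val \in subalg_pred }.

HB.instance Definition _ := [isSub for subalg_val].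
HB.instance Definition _ := [Choice of subalg by <:].
HB.instance Definition _ := [SubChoice_isSubAlgebra of subalg by <:].

(** The universal property quantifies over [algType], so a predicate must first be turned into an
    algebra of its own, together with its inclusion. *)
Lemma subalgebra_exists : exists (S : algType K) (inc : S -> A),
  [/\ alg_hom inc, injective inc & forall a, P a <-> exists s, inc s = a].
Proof.
exists subalg, subalg_val; split.
- by split.
- exact: val_inj.
- move=> a; split=> [Pa | [[s /asboolP Ps] <-] //].
  have sa : a \in subalg_pred by apply/asboolP.
  by exists (Subalg sa).
Qed.

End Subalgebra.

(** * Induction over the generators of A_Z *)

Section LocalizationInduction.
Variables (K : fieldType) (n : nat) (q : 'I_n -> K) (lam : 'I_n -> 'I_n -> K).
Variables (B : unitAlgType K) (x y : 'I_n -> B).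
Hypothesis hB : is_loc_qweyl q lam x y.

(** The subalgebra [P] contains the generators and the inverses of the z_i, so the universal
    property maps A_Z into it; followed by the inclusion, this map fixes the generators, hence is
    the identity by uniqueness. *)
Lemma loc_qweyl_ind (P : B -> Prop) :
  P 1 -> (forall (k : K) a b, P a -> P b -> P (k *: a + b)) ->
  (forall a b, P a -> P b -> P (a * b)) ->
  (forall i, P (x i)) -> (forall i, P (y i)) ->
  (forall i, P (zel x y i)^-1) -> forall b, P b.
Proof.
move=> P1 PL PM Px Py Pz b.
have [S [inc [inc_hom inc_inj incP]]] := subalgebra_exists P1 PL PM.
have [incD incZ incM inc1] := inc_hom.
have incN a : inc (- a) = - inc a by rewrite -!scaleN1r incZ.
have [rel zu ex uniq] := hB.
have /choice [X Xx] : forall i, exists s, inc s = x i by move=> i; apply/incP.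
have /choice [Y Yy] : forall i, exists s, inc s = y i by move=> i; apply/incP.
have incz i : inc (zel X Y i) = zel x y i by rewrite /zel incD incN !incM !Xx !Yy.
case: (ex S X Y).
- split=> [i j ij | i]; last first.
    by apply: inc_inj; rewrite incD incN incZ !incM inc1 Xx Yy; exact: rel.2.
  have [r1 r2 r3 r4] := rel.1 i j ij.
  by split; apply: inc_inj; rewrite incZ !incM ?Xx ?Yy.
- move=> i; have /incP [t tz] := Pz i.
  by exists t; split; apply: inc_inj; rewrite incM inc1 tz incz ?mulrV ?mulVr.
move=> f [f_hom fxy]; apply/incP; exists (f b).
apply: (uniq B (inc \o f) id); last 1 first.
- by move=> i; rewrite /= !(fxy i).1 !(fxy i).2.
- have [fD fZ fM f1] := f_hom.
  by split=> * /=; rewrite ?fD ?fZ ?fM ?f1 ?incD ?incZ ?incM ?inc1.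
- by split.
Qed.

End LocalizationInduction.

(** * Lexicographic order on Z^n *)

Section LexicographicOrder.
Variable n : nat.
Local Notation G := {ffun 'I_n -> int}.

Definition lexlt (a b : G) : bool :=
  [exists i, (a i < b i) && [forall j : 'I_n, (j < i)%N ==> (a j == b j)]].

Lemma lexltP (a b : G) :
  reflect (exists2 i, a i < b i & forall j : 'I_n, (j < i)%N -> a j = b j)
          (lexlt a b).
Proof.
apply: (iffP existsP) => [[i /andP[ab /forallP e]] | [i ab e]].
  by exists i => // j ji; apply/eqP/(implyP (e j)).
by exists i; rewrite ab; apply/forallP => j; apply/implyP => /e ->.
Qed.

Lemma lexlt_irr a : lexlt a a = false.
Proof. by apply/lexltP => -[i]; rewrite ltxx. Qed.

Lemma lexlt_trans : transitive lexlt.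
Proof.
move=> b a c /lexltP[i ab e] /lexltP[k bc f]; apply/lexltP.
case: (ltngtP i k) => [ik | ki | /val_inj ik].
- exists i => [|j ji]; first by rewrite -f.
  by rewrite e // f // (ltn_trans ji).
- exists k => [|j jk]; first by rewrite e.
  by rewrite e ?f // (ltn_trans jk).
- by subst k; exists i => [|j ji]; [apply: lt_trans bc | rewrite e ?f].
Qed.

Lemma lexlt_total a b : a != b -> lexlt a b || lexlt b a.
Proof.
move=> ab; have /existsP[i0 i0P] : [exists i, a i != b i].
  by apply: contraR ab => /existsPn ab; apply/eqP/ffunP => i; apply/eqP/negbNE.
have [i ne_i min_i] := @arg_minnP _ i0 (fun i => a i != b i) (fun i => val i) i0P.
have e (j : 'I_n) : (j < i)%N -> a j = b j.
  by move=> ji; apply/eqP; apply: contraLR ji => /min_i; rewrite -leqNgt.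
case: (ltgtP (a i) (b i)) ne_i => [lt_i | lt_i | //] _.
- by apply/orP; left; apply/lexltP; exists i.
- by apply/orP; right; apply/lexltP; exists i => // j /e.
Qed.

Lemma lexltD c a b : lexlt a b -> lexlt (c + a) (c + b).
Proof.
move=> /lexltP[i ab e]; apply/lexltP; exists i; first by rewrite !ffunE ltrD2l.
by move=> j /e; rewrite !ffunE => ->.
Qed.

End LexicographicOrder.

(** * Homogeneous elements for an ordered group, and leading terms *)

Section Grading.
Variables (G : zmodType) (R : nzRingType) (H : G -> R -> Prop).
Hypotheses (H0 : forall g, H g 0) (HN : forall g a, H g a -> H g (- a)).
Hypothesis HD : forall g a b, H g a -> H g b -> H g (a + b).
Hypothesis HM : forall g h a b, H g a -> H h b -> H (g + h) (a * b).
Hypothesis Hindep : forall (S : seq G) F, uniq S -> (forall g, H g (F g)) ->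
  \sum_(g <- S) F g = 0 -> forall g, g \in S -> F g = 0.
Hypothesis Hreg : forall g h a b, H g a -> H h b -> a * b = 0 -> a = 0 \/ b = 0.

(** Degrees may repeat in [l], so concatenating lists or multiplying them termwise needs no normal
    form. *)
Definition gcomp (l : seq (G * R)) g := \sum_(t <- l | t.1 == g) t.2.

Lemma gcomp_cons t l g :
  gcomp (t :: l) g = (if t.1 == g then t.2 else 0) + gcomp l g.
Proof. by rewrite /gcomp big_cons; case: eqP; rewrite ?add0r. Qed.

Lemma gcomp_seq1 t g : gcomp [:: t] g = if t.1 == g then t.2 else 0.
Proof. by rewrite gcomp_cons /gcomp big_nil addr0. Qed.

Definition graded_sum (u : R) := exists S F,
  [/\ uniq S, forall g, H g (F g), forall g, g \in S -> F g != 0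
    & u = \sum_(g <- S) F g].

Lemma gcompH l : (forall t, t \in l -> H t.1 t.2) -> forall g, H g (gcomp l g).
Proof.
move=> lH g; rewrite /gcomp big_seq_cond.
by elim/big_rec: _ => // t a /andP[tl /eqP <-] Ha; apply: HD => //; exact: lH.
Qed.

Lemma sum_gcomp l : \sum_(t <- l) t.2 = \sum_(g <- undup (unzip1 l)) gcomp l g.
Proof.
rewrite /gcomp (exchange_big_dep xpredT) //= big_seq [RHS]big_seq.
apply: eq_bigr => t tl.
rewrite (eq_bigl (fun g => g == t.1)); last by move=> g; rewrite eq_sym.
rewrite -big_filter (perm_big [:: t.1]) ?big_seq1 //=.
apply: uniq_perm; rewrite ?filter_uniq ?undup_uniq // => g.
rewrite mem_filter mem_undup inE; case: eqP => //= ->.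
by apply/mapP; exists t.
Qed.

Lemma graded_sumP l : (forall t, t \in l -> H t.1 t.2) ->
  graded_sum (\sum_(t <- l) t.2).
Proof.
move=> lH; exists [seq g <- undup (unzip1 l) | gcomp l g != 0], (gcomp l).
rewrite filter_uniq ?undup_uniq //; split=> //; first exact: gcompH.
  by move=> g; rewrite mem_filter => /andP[].
rewrite sum_gcomp big_filter [LHS](bigID (fun g => gcomp l g != 0)) /=.
by rewrite [X in _ + X]big1 ?addr0 // => g /negbNE/eqP.
Qed.

Lemma gcomp_eq0 l : (forall t, t \in l -> H t.1 t.2) ->
  \sum_(t <- l) t.2 = 0 -> forall g, gcomp l g = 0.
Proof.
move=> lH; rewrite sum_gcomp => s0 g.
have [gl|gl] := boolP (g \in undup (unzip1 l)).
  by apply: (Hindep _ _ s0) => //; [exact: undup_uniq | exact: gcompH].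
rewrite /gcomp big_seq_cond big1 // => t /andP[tl /eqP tg].
by case/negP: gl; rewrite mem_undup -tg; apply: map_f.
Qed.

(** Appending the negated second list to the first gives a representation of 0, whose components
    vanish by independence. *)
Lemma gcomp_eq l l' : (forall t, t \in l -> H t.1 t.2) ->
  (forall t, t \in l' -> H t.1 t.2) ->
  \sum_(t <- l) t.2 = \sum_(t <- l') t.2 -> gcomp l =1 gcomp l'.
Proof.
move=> lH l'H e g.
have := @gcomp_eq0 (l ++ [seq (t.1, - t.2) | t <- l']) _ _ g.
rewrite /gcomp !big_cat !big_map /= !sumrN e subrr.
move=> h; apply/eqP; rewrite -subr_eq0; apply/eqP/h => // t.
by rewrite mem_cat => /orP[/lH // | /mapP[s /l'H sH ->]]; apply: HN.
Qed.

Section Top.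
Variable lt : rel G.
Hypotheses (lt_irr : forall a, lt a a = false) (lt_trans : transitive lt).
Hypothesis lt_total : forall a b, a != b -> lt a b || lt b a.
Hypothesis ltD : forall c a b, lt a b -> lt (c + a) (c + b).

Lemma seq_max (S : seq G) : S != [::] ->
  exists2 m, m \in S & forall g, g \in S -> g != m -> lt g m.
Proof.
elim: S => // a S IH _; have [->|/IH [m mS mP]] := eqVneq S [::].
  by exists a; rewrite ?inE // => g; rewrite inE => /eqP ->; rewrite eqxx.
have [ma|] := boolP (lt m a).
  exists a; rewrite ?inE ?eqxx // => g; rewrite inE => /orP[/eqP ->|gS _].
    by rewrite eqxx.
  by have [->|/(mP _ gS)] := eqVneq g m => // gm; apply: lt_trans ma.
move=> ma; exists m; rewrite ?inE ?mS ?orbT // => g; rewrite inE => /orP[/eqP ->|/mP //].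
by move=> am; have := lt_total am; rewrite (negPf ma) orbF.
Qed.

(** The pair of top degrees is the only one with sum [m + m'], and a product of nonzero homogeneous
    elements is nonzero. The conclusion covers every list representing the product, so that a
    convenient one can be chosen later. *)
Lemma top_product (u u' : R) S F S' F' :
  uniq S -> uniq S' -> (forall g, H g (F g)) -> (forall g, H g (F' g)) ->
  (forall g, g \in S -> F g != 0) -> (forall g, g \in S' -> F' g != 0) ->
  u = \sum_(g <- S) F g -> u' = \sum_(g <- S') F' g -> S != [::] -> S' != [::] ->
  exists m m', [/\ m \in S, m' \in S',
    forall g, g \in S -> g != m -> lt g m,
    forall g, g \in S' -> g != m' -> lt g m'
    & forall l, (forall t, t \in l -> H t.1 t.2) -> u * u' = \sum_(t <- l) t.2 ->
        gcomp l (m + m') != 0].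
Proof.
move=> uS uS' HF HF' nF nF' -> -> /seq_max [m mS mP] /seq_max [m' mS' mP'].
exists m, m'; split=> // l lH e.
set l0 := [seq (g + g', F g * F' g') | g <- S, g' <- S'].
have l0H t : t \in l0 -> H t.1 t.2 by move=> /allpairsP[[g g'] /= [_ _ ->]]; exact: HM.
have e0 : \sum_(t <- l) t.2 = \sum_(t <- l0) t.2.
  rewrite -e big_allpairs_dep mulr_suml; apply: eq_bigr => g _.
  by rewrite mulr_sumr.
rewrite (gcomp_eq lH l0H e0) /gcomp big_mkcond big_allpairs_dep /=.
rewrite (bigD1_seq m) //= [X in _ + X]big_seq_cond [X in _ + X]big1 => [|g /andP[gS gm]].
  rewrite addr0 (bigD1_seq m') //= eqxx big1_seq => [|g' /andP[gm' gS']].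
    rewrite addr0; apply/eqP => /(Hreg (HF _) (HF' _)).
    by case=> /eqP; [apply/negP/nF | apply/negP/nF'].
  by rewrite (inj_eq (addrI _)) (negPf gm').
rewrite big1_seq // => g' /andP[_ gS']; case: eqP => // gg'.
have h : lt (g + g') (m + m').
  rewrite [g + _]addrC [m + _]addrC; have h := ltD g' (mP _ gS gm).
  have [<- //|gm'] := eqVneq g' m'; apply: lt_trans h _.
  by rewrite [g' + _]addrC [m' + _]addrC; exact/ltD/mP'.
by rewrite gg' lt_irr in h.
Qed.

End Top.

Section Ordered.
Variable lt : rel G.
Hypotheses (lt_irr : forall a, lt a a = false) (lt_trans : transitive lt).
Hypothesis lt_total : forall a b, a != b -> lt a b || lt b a.
Hypothesis ltD : forall c a b, lt a b -> lt (c + a) (c + b).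

Lemma graded_domain u u' : graded_sum u -> graded_sum u' -> u * u' = 0 ->
  u = 0 \/ u' = 0.
Proof.
move=> [S [F [uS HF nF eu]]] [S' [F' [uS' HF' nF' eu']]] uu0.
have [S0|Sn] := eqVneq S [::]; first by left; rewrite eu S0 big_nil.
have [S0|Sn'] := eqVneq S' [::]; first by right; rewrite eu' S0 big_nil.
(* The empty list represents the product 0 and has no nonzero component. *)
have [m [m' [_ _ _ _ /(_ [::])]]] := top_product lt_irr lt_trans lt_total ltD
  uS uS' HF HF' nF nF' eu eu' Sn Sn'.
by rewrite big_nil /gcomp big_nil eqxx => /(_ _ uu0) h; suff: false by []; exact: h.
Qed.

(** The top and the bottom degree of the product both equal [e], and they are the sums of the
    extreme degrees of the factors; so the extreme degrees of [u] coincide. *)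
Lemma graded_factor_homogeneous u u' e : graded_sum u -> graded_sum u' ->
  H e (u * u') -> u * u' != 0 -> exists d, H d u.
Proof.
move=> [S [F [uS HF nF eu]]] [S' [F' [uS' HF' nF' eu']]] Huu uu0.
have [S0|Sn] := eqVneq S [::]; first by rewrite eu S0 big_nil mul0r eqxx in uu0.
have [S0|Sn'] := eqVneq S' [::]; first by rewrite eu' S0 big_nil mulr0 eqxx in uu0.
have lH t : t \in [:: (e, u * u')] -> H t.1 t.2 by rewrite inE => /eqP ->.
have deg g : gcomp [:: (e, u * u')] g != 0 -> g = e.
  by rewrite gcomp_seq1 /=; have [->|_] := eqVneq e g; rewrite ?eqxx.
have [m [m' [mS mS' mP mP' /(_ _ lH)]]] := top_product lt_irr lt_trans lt_total ltD
  uS uS' HF HF' nF nF' eu eu' Sn Sn'.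
rewrite big_seq1 => /(_ erefl)/deg mm.
(* The reversed order obeys the same axioms; [top_product] then yields the lowest degrees [k] and
   [k']. *)
have gt_trans : transitive (fun a b => lt b a) by move=> a b c h /lt_trans; exact.
have gt_total a b : a != b -> lt b a || lt a b by rewrite orbC; exact: lt_total.
have gtD c a b : lt b a -> lt (c + b) (c + a) by exact: ltD.
have [k [k' [kS kS' kP kP' /(_ _ lH)]]] := top_product lt_irr gt_trans gt_total gtD
  uS uS' HF HF' nF nF' eu eu' Sn Sn'.
rewrite big_seq1 => /(_ erefl)/deg kk.
(* Otherwise [k + k'] would lie strictly below [m + m'], while both equal [e]. *)
have km : k = m.
  apply/eqP/negPn/negP => km; have h := ltD k' (mP _ kS km).
  have : lt (k' + k) (m' + m).
    have [<- //|km'] := eqVneq k' m'; apply: lt_trans h _.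
    by rewrite [k' + _]addrC [m' + _]addrC; exact/ltD/mP'.
  by rewrite addrC kk [m' + _]addrC mm lt_irr.
exists m; suff -> : u = F m by [].
rewrite eu (bigD1_seq m) //= big_seq_cond big1 ?addr0 // => g /andP[gS gm].
have gk : g != k by rewrite km.
by have := lt_trans (mP _ gS gm); rewrite -km => /(_ _ (kP _ gS gk)); rewrite lt_irr.
Qed.

End Ordered.
End Grading.

(** * Generators of A_Z and their weights *)

Section QuantumWeyl.
Variables (K : fieldType) (n : nat) (q : 'I_n -> K) (lam : 'I_n -> 'I_n -> K).
Hypotheses (hq : forall i, q i != 0) (hlam0 : forall i j, lam i j != 0).
Hypothesis hlamV : forall i j, lam i j = (lam j i)^-1.
Hypothesis hgen :
  forall e : 'I_n -> int, \prod_(k < n) q k ^ e k = 1 -> forall k, e k = 0.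
Variables (B : unitAlgType K) (x y : 'I_n -> B).
Hypothesis hB : is_loc_qweyl q lam x y.
(* Locked, so that rewriting rules for sums do not see through [z]. *)
Definition z (i : 'I_n) : B := locked (zel x y i).

Lemma zE i : z i = zel x y i. Proof. by rewrite /z -lock. Qed.
Local Notation G := {ffun 'I_n -> int}.

(** A boolean covers x_i and y_i by one statement: negation exchanges them, and [sg] gives the sign
    of their weight. *)
Definition gx (s : bool) i := if s then x i else y i.
Definition sg (s : bool) : int := if s then 1 else -1.
Definition dl i (k : int) : G := [ffun j => if j == i then k else 0].

Lemma sgN s : sg (~~ s) = - sg s.
Proof. by case: s; rewrite ?opprK. Qed.

Lemma q_expz_eq1 i k : q i ^ k = 1 -> k = 0.
Proof.
move=> h; have := hgen (e := fun j => if j == i then k else 0) _ i; rewrite eqxx; apply.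
by rewrite (bigD1 i) //= eqxx h mul1r big1 // => j /negPf ->; rewrite expr0z.
Qed.

Lemma q_expz2_eq1 i j k l : i != j -> q i ^ k * q j ^ l = 1 -> k = 0 /\ l = 0.
Proof.
move=> ij h; set e := fun a => if a == i then k else if a == j then l else 0.
have e0 : forall a, e a = 0.
  apply: hgen; rewrite (bigD1 i) //= (bigD1 j) 1?eq_sym //= mulrA.
  rewrite {1 2}/e !eqxx [j == i]eq_sym (negPf ij) h mul1r big1 // => a /andP[ai aj].
  by rewrite /e (negPf ai) (negPf aj) expr0z.
by have := e0 j; have := e0 i; rewrite /e !eqxx [j == i]eq_sym (negPf ij).
Qed.

Lemma q_neq1 i : q i != 1.
Proof. by apply/eqP => h; have := @q_expz_eq1 i 1; rewrite expr1z => /(_ h). Qed.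

Lemma q_expz_inj i : injective (fun k : int => q i ^ k).
Proof.
move=> k l /= h; apply/eqP; rewrite -subr_eq0; apply/eqP/(@q_expz_eq1 i).
by rewrite expfzDr // h -expfzDr // subrr.
Qed.

Lemma lamM i j : lam i j * lam j i = 1.
Proof. by rewrite hlamV mulVf. Qed.

Lemma gx_comm s t i j : i != j ->
  gx s i * gx t j = (if s == t then lam i j else lam j i) *: (gx t j * gx s i).
Proof.
have [[rel _] _ _ _] := hB.
case: (ltngtP i j) => [ij _|ij _|/val_inj ->]; last by rewrite eqxx.
  have [r1 r2 r3 r4] := rel _ _ ij.
  by case: s; case: t => //=; rewrite ?r2 ?r4 scalerA lamM scale1r.
have [r1 r2 r3 r4] := rel _ _ ij.
by case: s; case: t => //=; rewrite ?r1 ?r3 scalerA lamM scale1r.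
Qed.

(** Inserting the relation into z_i = x_i y_i - y_i x_i gives (q_i - 1) y_i x_i = z_i - 1 and (q_i -
    1) x_i y_i = q_i z_i - 1; the boolean [s] is read as the exponent 0 or 1. *)
Lemma gx_mulN s i : (q i - 1) *: (gx s i * gx (~~ s) i) = q i ^+ s *: z i - 1.
Proof.
have [[_ /(_ i) r] _ _ _] := hB; rewrite -r zE /zel.
case: s; rewrite /= ?expr1 ?expr0 ?scale1r scalerBl scale1r opprB.
  by rewrite scalerBr addrA subrK.
by rewrite [RHS]addrC addrA subrK.
Qed.

Definition wt (d : G) (b : B) := forall j, b * z j = (q j ^ d j : K) *: (z j * b).

Lemma z_unit i : z i \is a GRing.unit.
Proof. by rewrite zE; have [_ h _ _] := hB. Qed.

(** For j different from i, the scalars met in crossing x_j and y_j are mutually inverse. For j = i,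
    write z_i through one product and q_i z_i through the other, and reassociate x_i (y_i x_i) =
    (x_i y_i) x_i; likewise for y_i. *)
Lemma wt_gx s i : wt (dl i (sg s)) (gx s i).
Proof.
move=> j; rewrite ffunE; have [->|ji] := eqVneq j i; last first.
  rewrite expr0z scale1r zE /zel -[x]/(gx true) -[y]/(gx false) mulrBr mulrBl !mulrA.
  have ij : i != j by rewrite eq_sym.
  have c t : gx s i * gx t j * gx (~~ t) j = gx t j * gx (~~ t) j * gx s i.
    rewrite (gx_comm s t ij) -scalerAl -[in LHS]mulrA (gx_comm s (~~ t) ij).
    rewrite -scalerAr scalerA mulrA.
    by case: s; case: t; rewrite /= lamM scale1r.
  by rewrite (c true) (c false).
have e0 : z i = (q i - 1) *: (y i * x i) + 1.
  by rewrite (gx_mulN false i) /= expr0 scale1r subrK.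
have e1 : q i *: z i = (q i - 1) *: (x i * y i) + 1.
  by rewrite (gx_mulN true i) /= expr1 subrK.
case: s => /=.
  rewrite expr1z scalerAl e1 {1}e0 mulrDr mulrDl mulr1 mul1r.
  by rewrite -scalerAr -scalerAl mulrA.
rewrite exprN1; apply: (scalerI (hq i)); rewrite scalerA mulfV // scale1r.
rewrite scalerAr e1 {1}e0 mulrDr mulrDl mulr1 mul1r.
by rewrite -scalerAr -scalerAl mulrA.
Qed.

Lemma wtM d e a b : wt d a -> wt e b -> wt (d + e) (a * b).
Proof.
move=> wa wb j; rewrite -mulrA wb -scalerAr [a * (_ * _)]mulrA wa -scalerAl scalerA mulrA.
by rewrite ffunE expfzDr // mulrC.
Qed.

Lemma wtL d (k : K) a b : wt d a -> wt d b -> wt d (k *: a + b).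
Proof.
move=> wa wb j; rewrite mulrDl mulrDr -scalerAl -scalerAr wa wb scalerDr.
by rewrite !scalerA mulrC.
Qed.

Lemma wt_0 d : wt d 0. Proof. by move=> j; rewrite mul0r mulr0 scaler0. Qed.

Lemma wtD d a b : wt d a -> wt d b -> wt d (a + b).
Proof. by move=> wa wb; rewrite -[a]scale1r; apply: wtL. Qed.

Lemma wtZ d (k : K) a : wt d a -> wt d (k *: a).
Proof. by move=> wa; rewrite -[_ *: a]addr0; apply: wtL => //; exact: wt_0. Qed.

Lemma wtN d a : wt d a -> wt d (- a).
Proof. by rewrite -scaleN1r; exact: wtZ. Qed.

Lemma wt0_1 : wt 0 1.
Proof. by move=> j; rewrite ffunE expr0z scale1r mul1r mulr1. Qed.

Lemma wt0_z i : wt 0 (z i).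
Proof.
have c s : wt 0 (gx s i * gx (~~ s) i).
  have -> : 0 = dl i (sg s) + dl i (sg (~~ s)).
    by apply/ffunP => j; rewrite !ffunE; case: eqP => // _; case: s.
  by apply: wtM; exact: wt_gx.
by rewrite zE; apply: wtD; [exact: (c true) | apply/wtN/(c false)].
Qed.

Lemma wt0_comm a i : wt 0 a -> GRing.comm a (z i).
Proof. by move=> /(_ i); rewrite ffunE expr0z scale1r. Qed.

Lemma commrZ (k : K) (a b : B) : GRing.comm a b -> GRing.comm a (k *: b).
Proof. by move=> ab; rewrite /GRing.comm -scalerAr ab scalerAl. Qed.

(** * Laurent monomials in the z_i and their linear independence *)

Definition zm (a : G) : B := \prod_(j < n) z j ^ a j.
(** A pairing of weights with exponents: the scalar picked up when an element of weight [d] crosses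
    [zm a]. *)
Definition chi (d a : G) : K := \prod_(j < n) q j ^ (d j * a j).

Lemma zexp_comm i j k l : GRing.comm (z i ^ k) (z j ^ l).
Proof.
apply: commrXz; apply: commr_sym; apply: commrXz; apply: commr_sym.
exact/wt0_comm/wt0_z.
Qed.

Lemma zmD a b : zm (a + b) = zm a * zm b.
Proof.
rewrite /zm -prodrM_comm => [|i j _ _]; last exact: zexp_comm.
by apply: eq_bigr => i _; rewrite ffunE exprzDr ?z_unit.
Qed.

Lemma zm0 : zm 0 = 1.
Proof. by rewrite /zm big1 // => i _; rewrite ffunE expr0z. Qed.

Lemma zmC a b : zm a * zm b = zm b * zm a.
Proof. by rewrite -!zmD addrC. Qed.

Lemma zmNl a : zm (- a) * zm a = 1.
Proof. by rewrite -zmD addNr zm0. Qed.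

Lemma zmNr a : zm a * zm (- a) = 1.
Proof. by rewrite -zmD addrN zm0. Qed.

Lemma zm_unit a : zm a \is a GRing.unit.
Proof. by apply/unitrP; exists (zm (- a)); rewrite zmNl zmNr. Qed.

Lemma zm_dl i k : zm (dl i k) = z i ^ k.
Proof.
rewrite /zm (eq_bigr (fun j => if j == i then z i ^ k else 1)); last first.
  by move=> j _; rewrite ffunE; case: eqP => [->|]; rewrite ?expr0z.
by rewrite -big_mkcond big_pred1_eq.
Qed.

Lemma chi_neq0 d a : chi d a != 0.
Proof. by apply/prodf_neq0 => j _; rewrite expfz_neq0. Qed.

Lemma chi_dl i k a : chi (dl i k) a = q i ^ (k * a i).
Proof.
rewrite /chi (eq_bigr (fun j => if j == i then q i ^ (k * a i) else 1)); last first.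
  by move=> j _; rewrite ffunE; case: eqP => [->|]; rewrite ?mul0r ?expr0z.
by rewrite -big_mkcond big_pred1_eq.
Qed.

Lemma skew_inv (b u : B) (c : K) : u \is a GRing.unit -> c != 0 ->
  b * u = c *: (u * b) -> b * u^-1 = c^-1 *: (u^-1 * b).
Proof.
move=> uu c0 h; apply: (scalerI c0); rewrite scalerA mulfV // scale1r.
by apply: (mulrI uu); rewrite -scalerAr !mulrA mulrV // mul1r scalerAl -h mulrK.
Qed.

Lemma wt_expz d b j k : wt d b -> b * z j ^ k = q j ^ (d j * k) *: (z j ^ k * b).
Proof.
move=> wb; have nat_case (m : nat) :
    b * z j ^+ m = q j ^ (d j * m) *: (z j ^+ m * b).
  elim: m => [|m IH]; first by rewrite !expr0 mulr0 expr0z mul1r mulr1 scale1r.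
  rewrite exprSr mulrA IH -scalerAl -[in LHS]mulrA wb -scalerAr scalerA mulrA.
  by rewrite -expfzDr // -[in RHS]addn1 PoszD mulrDr mulr1.
case: k => m; first exact: nat_case.
(* Negative exponents follow from positive ones by inverting the skew relation. *)
rewrite NegzE -!exprnN mulrN -invr_expz; apply: skew_inv => //.
- by rewrite unitrX ?z_unit.
- exact: expfz_neq0.
Qed.

Lemma wt_zm d b a : wt d b -> b * zm a = chi d a *: (zm a * b).
Proof.
move=> wb; rewrite /zm /chi; elim: (index_enum _) => [|j r IH].
  by rewrite !big_nil mulr1 mul1r scale1r.
rewrite !big_cons mulrA (wt_expz _ _ wb) -scalerAl -mulrA IH -scalerAr scalerA.
by rewrite !mulrA.
Qed.

Lemma wt0_zm a : wt 0 (zm a).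
Proof.
move=> j; rewrite ffunE expr0z scale1r -[z j]expr1z -(zm_dl j 1).
exact: zmC.
Qed.

Definition laurent (f : B) := exists l : seq (K * G), f = \sum_(t <- l) t.1 *: zm t.2.

Lemma laurentM f g : laurent f -> laurent g -> laurent (f * g).
Proof.
move=> [l ->] [l' ->]; exists [seq (s.1 * t.1, s.2 + t.2) | s <- l, t <- l'].
rewrite big_allpairs_dep mulr_suml; apply: eq_bigr => s _.
rewrite mulr_sumr; apply: eq_bigr => t _ /=.
by rewrite zmD -scalerAl -scalerAr scalerA.
Qed.

Lemma laurentL (k : K) f g : laurent f -> laurent g -> laurent (k *: f + g).
Proof.
move=> [l ->] [l' ->]; exists ([seq (k * t.1, t.2) | t <- l] ++ l').
rewrite big_cat big_map scaler_sumr; congr (_ + _).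
by apply: eq_bigr => t _; rewrite scalerA.
Qed.

Lemma laurent_zm (c : K) a : laurent (c *: zm a).
Proof. by exists [:: (c, a)]; rewrite big_seq1. Qed.

Lemma laurent0 : laurent 0.
Proof. by rewrite -[0](scale0r (zm 0)); exact: laurent_zm. Qed.

Lemma laurentD f g : laurent f -> laurent g -> laurent (f + g).
Proof. by move=> lf lg; rewrite -[f]scale1r; apply: laurentL. Qed.

Lemma laurentZ (k : K) f : laurent f -> laurent (k *: f).
Proof. by move=> lf; rewrite -[_ *: f]addr0; apply: laurentL => //; exact: laurent0. Qed.

Lemma laurentC (k : K) : laurent (k *: 1).
Proof. by rewrite -zm0; exact: laurent_zm. Qed.

Lemma laurent1 : laurent 1.
Proof. by rewrite -[1]scale1r; exact: laurentC. Qed.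

Lemma laurent_z i : laurent (z i).
Proof. by rewrite -[z i]expr1z -zm_dl -[zm _]scale1r; exact: laurent_zm. Qed.

Lemma laurent_lin (k : K) i : laurent (k *: z i - 1).
Proof.
by apply: laurentL; [exact: laurent_z | rewrite -scaleN1r; exact: laurentC].
Qed.

Lemma laurent_wt f : laurent f -> wt 0 f.
Proof.
move=> [l ->]; elim/big_rec: _ => [|t a _ wa]; first exact: wt_0.
by apply: wtL => //; exact: wt0_zm.
Qed.

Lemma laurent_comm f g : laurent f -> laurent g -> f * g = g * f.
Proof.
move=> /laurent_wt wf [l ->]; rewrite mulr_suml mulr_sumr; apply: eq_bigr => t _.
rewrite -scalerAr -scalerAl (wt_zm _ wf) /chi big1 ?scale1r // => j _.
by rewrite ffunE mul0r expr0z.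
Qed.

(* Roots q_i^-(k+1) for x_i and q_i^k for y_i: disjoint, as q_i is not a root of unity. *)
Definition killer (s : bool) i N : {poly K} :=
  \prod_(k < N) ((q i ^ (if s then k%:Z + 1 else - k%:Z))%:P * 'X - 1).

(** One factor at a time: multiplying f x_i^(N+1) = 0 by y_i replaces x_i y_i by an affine function
    of z_i, and moving z_i to the left of x_i^N shows that f (c z_i - 1) is killed by x_i^N. The
    case of y_i is symmetric. *)
Lemma killerP s i N (f : B) : GRing.comm f (z i) -> f * gx s i ^+ N = 0 ->
  f * horner_alg (z i) (killer s i N) = 0.
Proof.
elim: N f => [|N IH] f fz f0; first by rewrite /killer big_ord0 rmorph1.
set c := q i ^ (if s then N%:Z + 1 else - N%:Z).
rewrite /killer big_ord_recr /= mulrC rmorphM mulrA -/c /=.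
have -> : horner_alg (z i) (c%:P * 'X - 1) = c *: z i - 1.
  by rewrite rmorphB rmorph1 rmorphM /= horner_algX horner_algC mulr_algl.
apply: IH.
  apply: commr_sym; apply: commrM; first exact: commr_sym.
  by apply: commrB; [apply: commrZ | apply: commr1].
have wN m : gx s i ^+ m * z i = q i ^ (sg s * m) *: (z i * gx s i ^+ m).
  elim: m => [|m IHm]; first by rewrite mulr0 expr0z scale1r mul1r mulr1.
  rewrite exprS -mulrA IHm -scalerAr [gx s i * (z i * _)]mulrA (wt_gx s i i).
  rewrite -scalerAl scalerA [z i * (_ * _)]mulrA.
  by rewrite ffunE eqxx -expfzDr // -[in RHS]addn1 PoszD mulrDr mulr1.
have : (q i - 1) *: (f * gx s i ^+ N.+1 * gx (~~ s) i) =
    q i ^+ s *: (f * (gx s i ^+ N * z i)) - f * gx s i ^+ N.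
  rewrite exprSr -!mulrA scalerAr scalerAr gx_mulN.
  by rewrite !mulrBr mulr1 -!scalerAr.
rewrite f0 mul0r scaler0 wN -scalerAr scalerA => ->.
rewrite mulrBr mulr1 mulrBl -scalerAr -scalerAl mulrA; congr (_ *: _ - _).
(* The powers of q_i from crossing the N-th power and from [gx_mulN] combine to [c]: q_i^(N+1) for
   x_i, q_i^(-N) for y_i. *)
rewrite /c; case: s {f0 wN c} => /=; last by rewrite mulN1r mul1r.
by rewrite mul1r addrC expfzDr // expr1z.
Qed.

Lemma lin_coprime (c d : K) : c != d -> coprimep (c%:P * 'X - 1) (d%:P * 'X - 1).
Proof.
move=> cd; apply/Bezout_coprimepP; exists (d%:P, - c%:P) => /=; rewrite mulNr.
have -> : d%:P * (c%:P * 'X - 1) - c%:P * (d%:P * 'X - 1) = (c - d)%:P :> {poly K}.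
  rewrite !mulrBr !mulr1 !mulrA [d%:P * _]mulrC opprB polyCB.
  by rewrite addrACA [- _ + _]addrC addrACA subrr add0r.
by rewrite polyC_eqp1 subr_eq0.
Qed.

Lemma killer_coprime i N M : coprimep (killer true i N) (killer false i M).
Proof.
rewrite /killer; elim/big_rec: _ => [|k p _ IH]; first exact: coprime1p.
rewrite coprimepMl IH andbT; elim/big_rec: _ => [|l r _ IHr]; first exact: coprimep1.
rewrite coprimepMr IHr andbT; apply: lin_coprime; apply/eqP => /q_expz_inj h.
(* Equal coefficients would need k + 1 = -l with natural numbers k and l. *)
by move/eqP: h; rewrite -subr_eq0 opprK -!PoszD addn1.
Qed.

(** A Bezout identity for the two coprime polynomials, evaluated at z_i, shows that a nonzero scalar
    multiple of [f] is 0. *)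
Lemma kill_both i N M (f : B) : GRing.comm f (z i) ->
  f * x i ^+ N = 0 -> f * y i ^+ M = 0 -> f = 0.
Proof.
move=> fz /(killerP (s := true) fz) h1 /(killerP (s := false) fz) h2.
have /Bezout_coprimepP [[u v] /= /eqpP [[a b] /= /andP[_ b0]]] := killer_coprime i N M.
move=> /(congr1 (fun p => f * horner_alg (z i) p)).
rewrite -!mul_polyC !rmorphM rmorph1 !rmorphD /= !horner_algC !mulr_algl -!scalerAr mulr1.
rewrite [u * _]mulrC [v * _]mulrC !rmorphM /= mulrDr !mulrA h1 h2 !mul0r addr0 scaler0.
by move=> /esym/eqP; rewrite scaler_eq0 (negPf b0) => /eqP.
Qed.

(** Left multiplication by the generator, minus the eigenvalue of [k0] times right multiplication,
    removes [F k0] from the relation and turns every other [F k] into a nonzero multiple of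
    [F k * gx s i]. Induction applies to this shorter relation. *)
Lemma eigen_nilpotent s i (U : seq int) (F : int -> B) : uniq U ->
  (forall k, gx s i * F k = q i ^ (sg s * k) *: (F k * gx s i)) ->
  \sum_(k <- U) F k = 0 -> exists N, forall k, k \in U -> F k * gx s i ^+ N = 0.
Proof.
elim: U F => [|k0 U IH] F /=; first by exists 0%N.
move=> /andP[k0U uU] FP; rewrite big_cons => s0.
pose c k := q i ^ (sg s * k) - q i ^ (sg s * k0).
case: (IH (fun k => c k *: (F k * gx s i)) uU).
- by move=> k; rewrite -scalerAr mulrA FP -!scalerAl !scalerA mulrC.
- have : gx s i * (F k0 + \sum_(k <- U) F k)
      - q i ^ (sg s * k0) *: ((F k0 + \sum_(k <- U) F k) * gx s i) = 0.
    by rewrite s0 mulr0 mul0r scaler0 subr0.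
  rewrite mulrDr mulrDl FP scalerDr opprD addrACA subrr add0r => h.
  rewrite -[RHS]h mulr_sumr mulr_suml scaler_sumr -sumrB; apply: eq_bigr => k _.
  by rewrite FP scalerBl.
move=> N NP; exists N.+1.
have UP k : k \in U -> F k * gx s i ^+ N.+1 = 0.
  move=> kU; have := NP k kU; rewrite -scalerAl -mulrA -exprS => /eqP.
  rewrite scaler_eq0 subr_eq0 => /orP[/eqP/q_expz_inj h|/eqP //].
  have k0k : k = k0.
    by move: h; rewrite /sg; case: s {FP NP c IH}; rewrite ?mul1r ?mulN1r // => /oppr_inj.
  by rewrite k0k (negPf k0U) in kU.
(* [F k0] is minus the sum of the others, so the same power kills it. *)
move=> k; rewrite inE => /orP[/eqP -> |/UP //].
move/eqP: s0; rewrite addr_eq0 => /eqP ->; by rewrite mulNr mulr_suml big1_seq ?oppr0.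
Qed.

Definition monom_of (a : G) (f : B) := exists c : K, f = c *: zm a.

(** The part with exponent [k] at z_i is an eigenvector for both x_i and y_i, so powers of both kill
    it; it commutes with z_i, and [kill_both] applies. *)
Lemma coord_sum_eq0 i (S : seq G) F : (forall a, monom_of a (F a)) ->
  \sum_(a <- S) F a = 0 -> forall k, \sum_(a <- S | a i == k) F a = 0.
Proof.
move=> FP s0 k; pose l := [seq ((a : G) i, F a) | a <- S].
have lE m : gcomp l m = \sum_(a <- S | a i == m) F a by rewrite /gcomp big_map.
rewrite -lE.
have lP s m : gx s i * gcomp l m = q i ^ (sg s * m) *: (gcomp l m * gx s i).
  rewrite lE mulr_sumr mulr_suml scaler_sumr; apply: eq_bigr => a /eqP am.
  have [c ->] := FP a.
  by rewrite -scalerAr (wt_zm _ (wt_gx s i)) chi_dl am -scalerAl !scalerA mulrC.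
have sl : \sum_(m <- undup (unzip1 l)) gcomp l m = 0.
  by rewrite -sum_gcomp big_map.
have [kl|kl] := boolP (k \in undup (unzip1 l)); last first.
  rewrite /gcomp big_seq_cond big1 // => t /andP[tl /eqP tk].
  by case/negP: kl; rewrite mem_undup -tk; apply: map_f.
have [N NP] := eigen_nilpotent (undup_uniq _) (lP true) sl.
have [M MP] := eigen_nilpotent (undup_uniq _) (lP false) sl.
apply: kill_both (NP k kl) (MP k kl).
rewrite lE; apply: commr_sym; apply: commr_sum => a _.
have [c ->] := FP a; apply: commrZ; apply: commr_sym.
exact/wt0_comm/wt0_zm.
Qed.

(** Fixing the coordinates one after another splits the relation until only the term at [g] is
    left. *)
Lemma zm_indep (S : seq G) F : uniq S -> (forall a, monom_of a (F a)) ->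
  \sum_(a <- S) F a = 0 -> forall a, a \in S -> F a = 0.
Proof.
move=> uS FP s0 g gS.
have rP (r : seq 'I_n) : \sum_(a <- S | all (fun i => a i == g i) r) F a = 0.
  elim: r => [|i r IH] //=.
  rewrite -big_filter in IH.
  have := coord_sum_eq0 i FP IH (g i); rewrite big_filter_cond => h.
  by rewrite -[RHS]h; apply: eq_bigl => a; rewrite andbC.
have := rP (enum 'I_n); rewrite (eq_bigl (pred1 g)) => [|a /=].
  by rewrite -big_filter (perm_big [:: g]) ?big_seq1 // filter_pred1_uniq.
apply/allP/eqP => [h|-> i _ //]; apply/ffunP => i; apply/eqP/h.
by rewrite mem_enum.
Qed.

(** * Zero divisors and units among Laurent polynomials *)

Lemma monom0 a : monom_of a 0.
Proof. by exists 0; rewrite scale0r. Qed.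

Lemma monomN a f : monom_of a f -> monom_of a (- f).
Proof. by move=> [c ->]; exists (- c); rewrite scaleNr. Qed.

Lemma monomD a f g : monom_of a f -> monom_of a g -> monom_of a (f + g).
Proof. by move=> [c ->] [d ->]; exists (c + d); rewrite scalerDl. Qed.

Lemma monomM a b f g : monom_of a f -> monom_of b g -> monom_of (a + b) (f * g).
Proof.
move=> [c ->] [d ->]; exists (c * d).
by rewrite zmD -scalerAl -scalerAr scalerA.
Qed.

Lemma zm_neq0 a : zm a != 0.
Proof. by apply: contraTneq (zm_unit a) => ->; rewrite unitr0. Qed.

Lemma scale_zm_eq0 (c : K) a : (c *: zm a == 0) = (c == 0).
Proof. by rewrite scaler_eq0 (negPf (zm_neq0 a)) orbF. Qed.

Lemma monom_reg a b f g : monom_of a f -> monom_of b g -> f * g = 0 -> f = 0 \/ g = 0.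
Proof.
move=> [c ->] [d ->] /eqP; rewrite -scalerAl -scalerAr scalerA -zmD scale_zm_eq0.
by rewrite mulf_eq0 => /orP[] /eqP ->; rewrite scale0r; [left | right].
Qed.

Lemma laurent_graded f : laurent f -> graded_sum monom_of f.
Proof.
move=> [l ->].
have := graded_sumP monom0 monomD (l := [seq (t.2, t.1 *: zm t.2) | t <- l]).
by rewrite big_map; apply => _ /mapP[t _ ->]; exists t.1.
Qed.

Lemma laurent_domain f g : laurent f -> laurent g -> f * g = 0 -> f = 0 \/ g = 0.
Proof.
move=> /laurent_graded lf /laurent_graded lg.
exact: (graded_domain monom0 monomN monomD monomM zm_indep monom_reg
  (@lexlt_irr n) (@lexlt_trans n) (@lexlt_total n) (@lexltD n) lf lg).
Qed.

(** The monomials grade L by an ordered group, so a factor of a nonzero monomial is homogeneous,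
    that is, a monomial. *)
Lemma laurent_unit f g (c : K) a : laurent f -> laurent g -> f * g = c *: zm a ->
  c != 0 -> exists c' a', c' != 0 /\ f = c' *: zm a'.
Proof.
move=> /laurent_graded lf /laurent_graded lg fg c0.
have fg0 : f * g != 0 by rewrite fg scale_zm_eq0.
have [|d [c' fE]] := graded_factor_homogeneous (e := a) monom0 monomN monomD monomM
  zm_indep monom_reg (@lexlt_irr n) (@lexlt_trans n) (@lexlt_total n) (@lexltD n) lf lg _ fg0.
  by exists c.
exists c', d; split=> //; apply: contraNneq fg0 => c'0.
by rewrite fE c'0 scale0r mul0r.
Qed.

Lemma monom_gcomp_eq (l l' : seq (G * B)) : (forall t, t \in l -> monom_of t.1 t.2) ->
  (forall t, t \in l' -> monom_of t.1 t.2) ->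
  \sum_(t <- l) t.2 = \sum_(t <- l') t.2 -> gcomp l =1 gcomp l'.
Proof. exact: (gcomp_eq monom0 monomN monomD zm_indep). Qed.

Lemma zm_inj (c c' : K) a a' : c != 0 -> c *: zm a = c' *: zm a' -> a = a' /\ c = c'.
Proof.
move=> c0 e.
have := @monom_gcomp_eq [:: (a, c *: zm a)] [:: (a', c' *: zm a')].
rewrite !big_seq1 => /(_ _ _ e) h.
have {h} /(_ a) : gcomp [:: (a, c *: zm a)] =1 gcomp [:: (a', c' *: zm a')].
  by apply: h => t; rewrite inE => /eqP -> /=; [exists c | exists c'].
rewrite !gcomp_seq1 /= eqxx; have [aa _|_ /eqP] := eqVneq a' a.
  split=> //; move/eqP: e; rewrite aa -subr_eq0 -scalerBl scale_zm_eq0 subr_eq0.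
  by move=> /eqP.
by rewrite scale_zm_eq0 (negPf c0).
Qed.

Lemma dl1_neq0 i : dl i 1 != 0.
Proof. by apply/eqP => /ffunP/(_ i); rewrite !ffunE eqxx. Qed.

Lemma lin_neq0 (k : K) i : k *: z i - 1 != 0.
Proof.
have [->|k0] := eqVneq k 0; first by rewrite scale0r add0r oppr_eq0 oner_neq0.
apply/eqP => /eqP; rewrite subr_eq0 -[z i]expr1z -zm_dl -zm0 -[zm 0]scale1r => /eqP.
by move=> /(zm_inj k0) [/eqP]; rewrite (negPf (dl1_neq0 i)).
Qed.

(** A factor of a nonzero constant is a single monomial, while k z_i - 1 has two terms. *)
Lemma lin_not_unit (k : K) i h (c : K) : k != 0 -> laurent h ->
  (k *: z i - 1) * h = c *: 1 -> c = 0.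
Proof.
move=> k0 lh e; apply/eqP/negPn/negP => c0; rewrite -[in RHS]zm0 in e.
have [c' [a [c'0 fE]]] := laurent_unit (laurent_lin k i) lh e c0.
pose l := [:: (dl i 1, k *: zm (dl i 1)); (0, (-1) *: zm 0)].
have g : gcomp l =1 gcomp [:: (a, c' *: zm a)].
  apply: monom_gcomp_eq => [t|t|].
  - by rewrite !inE => /orP[] /eqP ->; eexists.
  - by rewrite inE => /eqP ->; eexists.
  - by rewrite big_cons !big_seq1 /= -fE zm_dl zm0 scaleN1r expr1z.
(* Comparison at exponent 0 makes the monomial constant; comparison at z_i then contradicts [k0]. *)
have a0 : a = 0.
  move/eqP: (g 0); rewrite gcomp_cons !gcomp_seq1 /= eqxx.
  rewrite (negPf (dl1_neq0 i)) add0r; have [//|_] := eqVneq a 0.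
  by rewrite scale_zm_eq0 oppr_eq0 oner_eq0.
have := g (dl i 1); rewrite gcomp_cons !gcomp_seq1 a0 /= eqxx.
rewrite [0 == _]eq_sym (negPf (dl1_neq0 i)) addr0 => /eqP.
by rewrite scale_zm_eq0 (negPf k0).
Qed.

(** Crossing [b] multiplies the coefficient of z^a by [chi d a]; as these scalars are nonzero and
    the monomials independent, the twist kills nothing. *)
Lemma laurent_twist d b f : wt d b -> laurent f ->
  exists f', [/\ laurent f', b * f = f' * b & f' = 0 -> f = 0].
Proof.
move=> wb /laurent_graded [S [F [uS HF _ ->]]].
exists (\sum_(a <- S) chi d a *: F a); split.
- elim/big_rec: _ => [|a f' _ lf']; first exact: laurent0.
  by apply: laurentL => //; have [c ->] := HF a; exact: laurent_zm.
- rewrite mulr_sumr mulr_suml; apply: eq_bigr => a _; have [c ->] := HF a.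
  by rewrite -!scalerAr (wt_zm _ wb) -!scalerAl !scalerA mulrC.
- have mF a : monom_of a (chi d a *: F a).
    by have [c ->] := HF a; exists (chi d a * c); rewrite scalerA.
  move=> /(zm_indep uS mF) h; rewrite big1_seq // => a /andP[_ /h /eqP].
  by rewrite scaler_eq0 (negPf (chi_neq0 d a)) => /eqP.
Qed.

Lemma laurent_twistr d b f : wt d b -> laurent f ->
  exists2 f', laurent f' & f * b = b * f'.
Proof.
move=> wb [l ->]; exists (\sum_(t <- l) (t.1 / chi d t.2) *: zm t.2).
  by exists [seq (t.1 / chi d t.2, t.2) | t <- l]; rewrite big_map.
rewrite mulr_sumr mulr_suml; apply: eq_bigr => t _.
by rewrite -scalerAr (wt_zm _ wb) scalerA divfK ?chi_neq0 // scalerAl.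
Qed.

(** * Skew commutation and the monomials V_d *)

Definition skew (a b : B) := exists2 c : K, c != 0 & a * b = c *: (b * a).

Lemma skew1 a : skew a 1.
Proof. by exists 1; rewrite ?oner_neq0 // scale1r mulr1 mul1r. Qed.

Lemma skewM a b b' : skew a b -> skew a b' -> skew a (b * b').
Proof.
move=> [c c0 e] [c' c'0 e']; exists (c * c'); first by rewrite mulf_neq0.
by rewrite mulrA e -scalerAl -[in LHS]mulrA e' -scalerAr scalerA mulrA.
Qed.

Lemma skewX a b m : skew a b -> skew a (b ^+ m).
Proof.
by move=> ab; elim: m => [|m IH]; [exact: skew1 | rewrite exprS; exact: skewM].
Qed.

Lemma skewC a b : skew a b -> skew b a.
Proof.
move=> [c c0 e]; exists c^-1; first by rewrite invr_eq0.
by rewrite e scalerA mulVf // scale1r.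
Qed.

Lemma skew_prod a (r : seq 'I_n) (P : pred 'I_n) F : (forall j, P j -> skew a (F j)) ->
  skew a (\prod_(j <- r | P j) F j).
Proof.
by move=> h; elim/big_rec: _ => [|j b /h]; [exact: skew1 | exact: skewM].
Qed.

Definition vp i (k : int) : B := gx (0 <= k) i ^+ `|k|%N.
Definition V (d : G) : B := \prod_(i < n) vp i (d i).
Definition rest i (d : G) : B := \prod_(j < n | j != i) vp j (d j).

Lemma skew_gx_vp s i j k : j != i -> skew (gx s i) (vp j k).
Proof.
move=> ji; apply: skewX.
exists (if s == (0 <= k) then lam i j else lam j i); first by case: ifP.
by apply: gx_comm; rewrite eq_sym.
Qed.

Lemma skew_gx_rest s i d : skew (gx s i) (rest i d).
Proof. by apply: skew_prod => j; exact: skew_gx_vp. Qed.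

(** Factors with different indices commute up to nonzero scalars, so the one at [i] can travel to
    the front. *)
Lemma V_pull i d : exists2 c : K, c != 0 & V d = c *: (vp i (d i) * rest i d).
Proof.
rewrite /V /rest.
elim: (index_enum _) (mem_index_enum i) (index_enum_uniq 'I_n) => // j r IH.
rewrite inE /= => ir /andP[jr ur]; rewrite !big_cons.
have [ji|ji] := eqVneq j i.
  exists 1; rewrite ?oner_neq0 // scale1r ji; congr (_ * _).
  rewrite big_seq_cond [RHS]big_seq_cond; apply: eq_bigl => k.
  by rewrite andbT; case: (boolP (k \in r)) => //= kr; case: eqP => // ki; rewrite ji -ki kr in jr.
have ir' : i \in r by move: ir; rewrite eq_sym (negPf ji).
have [c c0 ->] := IH ir' ur.
have [c' c'0 e] := skewX `|d i|%N (skewC (skew_gx_vp (0 <= d i) (d j) ji)).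
rewrite -/(vp i (d i)) in e.
exists (c * c'); first by rewrite mulf_neq0.
by rewrite -scalerAr mulrA e -scalerAl scalerA -mulrA.
Qed.

Lemma vp_pos i (m : nat) : vp i m%:Z = x i ^+ m.
Proof. by []. Qed.

Lemma vp_neg i (m : nat) : vp i (- m%:Z) = y i ^+ m.
Proof. by case: m => [|m]; rewrite ?oppr0 ?expr0 //. Qed.

Lemma vp_sg i s (m : nat) : vp i (sg s * m%:Z) = gx s i ^+ m.
Proof. by case: s; rewrite /sg ?mul1r ?mulN1r ?vp_pos ?vp_neg. Qed.

Lemma gx_mulN_laurent s i : exists2 h, laurent h & gx s i * gx (~~ s) i = h.
Proof.
exists ((q i - 1)^-1 *: (q i ^+ s *: z i - 1)); first exact/laurentZ/laurent_lin.
by rewrite -gx_mulN scalerA mulVf ?scale1r // subr_eq0 q_neq1.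
Qed.

Lemma gx_vp s i k : exists2 h, laurent h & gx s i * vp i k = h * vp i (k + sg s).
Proof.
(* Either the generator lengthens the power, or it meets its partner there and the pair collapses
   into L. *)
have [[m ->]|[m ->]] :
    (exists m : nat, k = sg s * m%:Z) \/ (exists m : nat, k = - (sg s * m.+1%:Z)).
- case: s; case: k => m; rewrite /sg ?NegzE.
  + by left; exists m; rewrite mul1r.
  + by right; exists m; rewrite mul1r.
  + by case: m => [|m]; [left; exists 0%N | right; exists m; rewrite mulN1r opprK].
  + by left; exists m.+1; rewrite mulN1r.
- exists 1; first exact: laurent1.
  by rewrite mul1r vp_sg -exprS -vp_sg -addn1 PoszD mulrDr mulr1.
have [h lh hE] := gx_mulN_laurent s i; exists h => //.
rewrite -mulNr -sgN vp_sg exprS mulrA hE -vp_sg; congr (_ * vp i _).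
by rewrite sgN -addn1 PoszD mulrDr mulr1 mulNr addrNK.
Qed.

Lemma wtX d b m : wt d b -> wt (d *+ m) (b ^+ m).
Proof.
move=> wb; elim: m => [|m IH]; first by rewrite mulr0n; exact: wt0_1.
by rewrite exprS mulrS; exact: wtM.
Qed.

Lemma wt_vp i k : wt (dl i k) (vp i k).
Proof.
have -> : dl i k = dl i (sg (0 <= k)) *+ `|k|%N.
  apply/ffunP => j; rewrite ffunMnE !ffunE; case: eqP => _; last by rewrite mul0rn.
  by case: k => m; rewrite /= ?NegzE ?mulNrn ?mulr1n -?natz ?mulr1n // -natz.
exact/wtX/wt_gx.
Qed.

Lemma sum_dl (d : G) : d = \sum_(i < n) dl i (d i).
Proof.
apply/ffunP => j; rewrite sum_ffunE (bigD1 j) //= ffunE eqxx big1 ?addr0 // => i ij.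
by rewrite ffunE eq_sym (negPf ij).
Qed.

Lemma wt_V d : wt d (V d).
Proof.
rewrite {1}(sum_dl d).
rewrite /V; elim: (index_enum _) => [|i r IH]; first by rewrite !big_nil; exact: wt0_1.
by rewrite !big_cons; apply: wtM => //; exact: wt_vp.
Qed.

Lemma V0 : V 0 = 1.
Proof. by rewrite /V big1 // => i _; rewrite ffunE. Qed.

Lemma V_dl s i : V (dl i (sg s)) = gx s i.
Proof.
rewrite /V (eq_bigr (fun j => if j == i then gx s i else 1)); last first.
  move=> j _; rewrite ffunE; case: eqP => [->|] //.
  by rewrite -[sg s]mulr1 (vp_sg i s 1).
by rewrite -big_mkcond big_pred1_eq.
Qed.

Lemma gx_V s i d : exists2 h, laurent h & gx s i * V d = h * V (d + dl i (sg s)).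
Proof.
have [c c0 ->] := V_pull i d.
have [c' c'0 ->] := V_pull i (d + dl i (sg s)).
have [h lh hE] := gx_vp s i (d i).
have -> : rest i (d + dl i (sg s)) = rest i d.
  by apply: eq_bigr => j /negPf ji; rewrite !ffunE ji addr0.
rewrite !ffunE eqxx; exists ((c / c') *: h); first exact: laurentZ.
by rewrite -!scalerAr -scalerAl scalerA [c' * _]mulrC divfK // !mulrA hE.
Qed.

(** * Weight decomposition of A_Z *)

Definition hom_at d (b : B) := exists2 f, laurent f & b = f * V d.

Lemma hom0 d : hom_at d 0.
Proof. by exists 0; [exact: laurent0 | rewrite mul0r]. Qed.

Lemma homD d a b : hom_at d a -> hom_at d b -> hom_at d (a + b).
Proof.
by move=> [f lf ->] [g lg ->]; exists (f + g); [exact: laurentD | rewrite mulrDl].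
Qed.

Lemma hom_laurent d f b : laurent f -> hom_at d b -> hom_at d (f * b).
Proof.
by move=> lf [g lg ->]; exists (f * g); [exact: laurentM | rewrite mulrA].
Qed.

Lemma hom_gx s i d b : hom_at d b -> hom_at (d + dl i (sg s)) (gx s i * b).
Proof.
move=> [f lf ->]; have [f' [lf' e _]] := laurent_twist (wt_gx s i) lf.
have [h lh hE] := gx_V s i d; exists (f' * h); first exact: laurentM.
by rewrite mulrA e -!mulrA hE.
Qed.

Lemma hom_wt d b : hom_at d b -> wt d b.
Proof.
by move=> [f /laurent_wt wf ->]; have := wtM wf (wt_V d); rewrite add0r.
Qed.

Definition spanned (b : B) :=
  exists2 l : seq (G * B), (forall t, t \in l -> hom_at t.1 t.2) & b = \sum_(t <- l) t.2.

Lemma spannedP b : spanned b.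
Proof.
have map_span (e : G) (g : B) : (forall d c, hom_at d c -> hom_at (d + e) (g * c)) ->
    forall c, spanned c -> spanned (g * c).
  move=> h c [l lP ->]; exists [seq (t.1 + e, g * t.2) | t <- l].
    by move=> _ /mapP[t /lP tP ->]; exact: h.
  by rewrite big_map mulr_sumr.
(* The induction runs over left factors [a] acting on all spanned elements, a property stable under
   products; c = 1 then gives [b]. *)
suff h : forall a c, spanned c -> spanned (a * c).
  rewrite -[b]mulr1; apply: h; exists [:: (0, 1)]; last by rewrite big_seq1.
  by move=> t; rewrite inE => /eqP ->; exists 1; [exact: laurent1 | rewrite V0 mulr1].
move=> a; apply: (loc_qweyl_ind hB (P := fun a => forall c, spanned c -> spanned (a * c))).
- by move=> c; rewrite mul1r.
- move=> k a1 a2 h1 h2 c cP; have [l1 l1P e1] := h1 c cP; have [l2 l2P e2] := h2 c cP.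
  exists ([seq (t.1, k *: t.2) | t <- l1] ++ l2).
    move=> t; rewrite mem_cat => /orP[/mapP[s /l1P sP ->]|/l2P //] /=.
    by rewrite -[_ *: _]mul1r -scalerAr scalerAl; apply: hom_laurent => //; exact: laurentC.
  by rewrite big_cat big_map mulrDl -scalerAl e1 e2 scaler_sumr.
- by move=> a1 a2 h1 h2 c /h2/h1; rewrite mulrA.
- by move=> i; apply: (map_span (dl i 1)) => d c; exact: (hom_gx true).
- by move=> i; apply: (map_span (dl i (-1))) => d c; exact: (hom_gx false).
- move=> i; apply: (map_span 0) => d c; rewrite addr0; apply: hom_laurent.
  by rewrite -zE -exprN1 -zm_dl -[zm _]scale1r; exact: laurent_zm.
Qed.

(** Distinct weights differ at some j. Right multiplication by z_j, minus q_j^(g j) times left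
    multiplication, removes [F g] and rescales [F d] by a nonzero scalar, leaving a shorter
    relation. *)
Lemma wt_indep (S : seq G) F : uniq S -> (forall d, wt d (F d)) ->
  \sum_(d <- S) F d = 0 -> forall d, d \in S -> F d = 0.
Proof.
elim: S F => [|g S IH] F //= /andP[gS uS] FP; rewrite big_cons => s0.
have SP d : d \in S -> F d = 0.
  move=> dS; have [j dj] : exists j, d j != g j.
    apply/existsP; apply: contraR gS => /existsPn h.
    by suff <- : d = g by []; apply/ffunP => j; apply/eqP/negbNE.
  have : (q j ^ d j - q j ^ g j) *: F d = 0.
    apply: (IH (fun d => (q j ^ d j - q j ^ g j) *: F d)) => // [e|]; first exact: wtZ.
    apply: (mulrI (z_unit j)); rewrite mulr0.
    have h : (F g + \sum_(d <- S) F d) * z j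
        - q j ^ g j *: (z j * (F g + \sum_(d <- S) F d)) = 0.
      by rewrite s0 mulr0 mul0r scaler0 subr0.
    rewrite -[RHS]h mulrDr mulrDl FP scalerDr opprD addrACA subrr add0r.
    rewrite !mulr_sumr mulr_suml scaler_sumr -sumrB; apply: eq_bigr => e _.
    by rewrite FP -scalerAr scalerBl.
  move=> /eqP; rewrite scaler_eq0 subr_eq0 => /orP[/eqP/q_expz_inj h|/eqP //].
  by rewrite h eqxx in dj.
move=> d; rewrite inE => /orP[/eqP ->|/SP //].
by move: s0; rewrite big1_seq ?addr0 // => e /andP[_ /SP].
Qed.

Lemma wt_graded b : graded_sum wt b.
Proof.
have [l lP ->] := spannedP b.
by apply: (graded_sumP wt_0 wtD) => t /lP; exact: hom_wt.
Qed.

(** By [spannedP], [b] is a sum of elements of the L V_e, which are weight vectors; independence of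
    weights leaves only the component in L V_d. *)
Lemma wt_hom d b : wt d b -> hom_at d b.
Proof.
move=> wb; have [l lP bE] := spannedP b.
have e : gcomp [:: (d, b)] =1 gcomp l.
  apply: (gcomp_eq wt_0 wtN wtD wt_indep) => [t|t /lP /hom_wt //|]; last by rewrite big_seq1.
  by rewrite inE => /eqP ->.
have := e d; rewrite gcomp_seq1 /= eqxx => ->.
exact: (gcompH hom0 homD).
Qed.

Lemma wt0_laurent b : wt 0 b -> laurent b.
Proof. by move=> /wt_hom [f lf ->]; rewrite V0 mulr1. Qed.

Lemma wt_dl_gx s i b : wt (dl i (sg s)) b -> exists2 f, laurent f & b = f * gx s i.
Proof. by move=> /wt_hom; rewrite /hom_at V_dl. Qed.

(** * Zero divisors and units of A_Z *)

Definition lreg (b : B) :=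
  (exists d, wt d b) /\ forall f, laurent f -> f * b = 0 -> f = 0.

Lemma lreg1 : lreg 1.
Proof. by split; [exists 0; exact: wt0_1 | move=> f _; rewrite mulr1]. Qed.

(** If f b x_i = 0, multiplying by y_i and moving z_i across the weight vector [b] gives f (k z_i -
    1) b = 0 for a scalar k; regularity of [b] and the absence of zero divisors in L give f = 0. The
    same works for y_i. *)
Lemma lreg_gx b s i : lreg b -> lreg (b * gx s i).
Proof.
move=> [[d wb] rb]; split; first by exists (d + dl i (sg s)); apply/wtM/wt_gx.
move=> f lf e; have : (q i - 1) *: (f * (b * gx s i) * gx (~~ s) i) = 0.
  by rewrite e mul0r scaler0.
rewrite -!mulrA scalerAr scalerAr gx_mulN mulrBr mulr1 -scalerAr wb scalerA.
set k := (_ * _ : K) => h.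
have : f * (k *: z i - 1) = 0.
  apply: rb; first by apply: laurentM => //; exact: laurent_lin.
  by rewrite -mulrA mulrBl mul1r -scalerAl.
move=> /(laurent_domain lf (laurent_lin k i)) [//|/eqP].
by rewrite (negPf (lin_neq0 k i)).
Qed.

Lemma lreg_V b d : lreg b -> lreg (b * V d).
Proof.
rewrite /V; elim: (index_enum _) b => [|i r IH] b rb; first by rewrite big_nil mulr1.
rewrite big_cons mulrA; apply: IH; rewrite /vp; elim: `|_|%N => [|m IHm].
  by rewrite mulr1.
by rewrite exprSr mulrA; exact: lreg_gx.
Qed.

(** Moving g to the left of V_d turns f V_d g V_e into f g' V_d V_e, and V_d V_e is regular against
    L. *)
Lemma wt_reg d e a b : wt d a -> wt e b -> a * b = 0 -> a = 0 \/ b = 0.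
Proof.
move=> /wt_hom [f lf ->] /wt_hom [g lg ->] h.
have [g' [lg' gE g0]] := laurent_twist (wt_V d) lg.
have [_ reg] := lreg_V e (lreg_V d lreg1).
have : f * g' = 0.
  by apply: reg; [exact: laurentM | rewrite -[RHS]h mul1r mulrA -[f * g' * _]mulrA -gE !mulrA].
move=> /(laurent_domain lf lg') [->|/g0 ->]; first by left; rewrite mul0r.
by right; rewrite mul0r.
Qed.

Lemma loc_domain (a b : B) : a * b = 0 -> a = 0 \/ b = 0.
Proof.
exact: (graded_domain wt_0 wtN wtD wtM wt_indep wt_reg
  (@lexlt_irr n) (@lexlt_trans n) (@lexlt_total n) (@lexltD n) (wt_graded a) (wt_graded b)).
Qed.

Lemma unit_wt u : u \is a GRing.unit -> exists d, wt d u.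
Proof.
move=> uu; apply: (graded_factor_homogeneous (u' := u^-1) (e := 0) wt_0 wtN wtD wtM wt_indep wt_reg
  (@lexlt_irr n) (@lexlt_trans n) (@lexlt_total n) (@lexltD n)); rewrite ?mulrV ?oner_neq0 //.
- exact: wt_graded.
- exact: wt_graded.
- exact: wt0_1.
Qed.

(** In a domain a right inverse is two-sided, so it commutes with every z_j as k z_i - 1 does. Hence
    it has weight 0 and lies in L, which [lin_not_unit] excludes. *)
Lemma lin_no_inv (k : K) i b : k != 0 -> (k *: z i - 1) * b <> 1.
Proof.
move=> k0 e; have e' : b * (k *: z i - 1) = 1.
  apply/eqP; rewrite -subr_eq0; apply/eqP.
  have /loc_domain [/eqP|//] : (k *: z i - 1) * (b * (k *: z i - 1) - 1) = 0.
    by rewrite mulrBr mulrA e mulr1 mul1r subrr.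
  by rewrite (negPf (lin_neq0 k i)).
have wb : wt 0 b.
  move=> j; rewrite ffunE expr0z scale1r.
  have c : (k *: z i - 1) * z j = z j * (k *: z i - 1).
    by apply: laurent_comm; [exact: laurent_lin | exact: laurent_z].
  by rewrite -[LHS]mulr1 -e -mulrA [z j * _]mulrA -c !mulrA e' mul1r.
have := lin_not_unit (c := 1) k0 (wt0_laurent wb); rewrite scale1r => /(_ i e) /eqP.
by rewrite oner_eq0.
Qed.

Lemma wt_inv d u : u \is a GRing.unit -> wt d u -> wt (- d) u^-1.
Proof.
move=> uu wu j; apply: (mulrI uu); rewrite mulrA mulrV // mul1r -scalerAr mulrA wu.
by rewrite -scalerAl mulrK // scalerA ffunE -expfzDr // addNr expr0z scale1r.
Qed.

(** If [d i] were nonzero of sign [s], then [u] would contain a factor [gx s i] and its inverse one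
    of [gx (~~ s) i]. Brought together in u u^-1 = 1, they form a factor k z_i - 1 with a right
    inverse. *)
Lemma unit_wt0 d u : u \is a GRing.unit -> wt d u -> d = 0.
Proof.
move=> uu wu; apply/ffunP => i; rewrite ffunE; apply/eqP/negPn/negP => di.
have [s [m dE]] : exists s (m : nat), d i = sg s * m.+1%:Z.
  case: (d i) di => [[//|m]|m] _; first by exists true, m; rewrite mul1r.
  by exists false, m; rewrite mulN1r NegzE.
have [f lf uE] := wt_hom wu; have [c c0 VE] := V_pull i d.
have [g lg vE] := wt_hom (wt_inv uu wu); have [c' c'0 VE'] := V_pull i (- d).
have [g' lg' gE] := laurent_twistr (wt_gx (~~ s) i) lg.
(* The monomial [V (- d)] contains [gx (~~ s) i], which is moved to the front across [g]. *)
have [w' w'E] : exists w', u^-1 = gx (~~ s) i * w'.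
  exists (c' *: (g' * gx (~~ s) i ^+ m * rest i (- d))).
  rewrite vE VE' ffunE dE -mulNr -sgN vp_sg exprS -!scalerAr; congr (_ *: _).
  by rewrite !mulrA gE.
have [c1 c10 sE] := skewC (skew_gx_rest (~~ s) i d).
(* [k] collects the scalar of [gx_mulN] and the one from moving z_i to the left of the remaining
   power of [gx s i]. *)
set k := q i ^+ s * q i ^ (sg s * m%:Z).
have k0 : k != 0 by rewrite mulf_neq0 ?expf_neq0 ?expfz_neq0.
set w := (c * c1) *: (f * vp i (sg s * m%:Z) * rest i d).
have wE : (q i - 1) *: (u * gx (~~ s) i) = (k *: z i - 1) * w.
  have -> : u * gx (~~ s) i =
      (c * c1) *: (f * (vp i (sg s * m%:Z) * (gx s i * gx (~~ s) i) * rest i d)).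
    rewrite uE VE dE vp_sg exprSr -vp_sg -!scalerAr -scalerAl -!mulrA sE -!scalerAr.
    by rewrite scalerA.
  rewrite scalerA mulrC -scalerA /w -[RHS]scalerAr; congr (_ *: _).
  have scale_in (e : K) a0 a1 a2 a3 : e *: (a0 * (a1 * a2 * a3)) = a0 * (a1 * (e *: a2) * a3) :> B.
    by rewrite -scalerAr -scalerAl -scalerAr.
  rewrite scale_in gx_mulN [vp i _ * (_ - 1)]mulrBr mulr1 -scalerAr.
  rewrite (wt_vp i (sg s * m%:Z) i) ffunE eqxx scalerA -/k.
  have -> : k *: (z i * vp i (sg s * m%:Z)) - vp i (sg s * m%:Z) =
      (k *: z i - 1) * vp i (sg s * m%:Z) by rewrite mulrBl mul1r scalerAl.
  by rewrite !mulrA (laurent_comm lf (laurent_lin k i)).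
apply: (@lin_no_inv k i ((q i - 1)^-1 *: (w * w')) k0).
rewrite -scalerAr mulrA -wE -scalerAl -mulrA -w'E mulrV // scalerA mulVf ?scale1r //.
by rewrite subr_eq0 q_neq1.
Qed.

Lemma unit_monom u : u \is a GRing.unit -> exists c a, c != 0 /\ u = c *: zm a.
Proof.
move=> uu; have [d wu] := unit_wt uu; have d0 := unit_wt0 uu wu; rewrite d0 in wu.
have wv := wt_inv uu wu; rewrite oppr0 in wv.
apply: (laurent_unit (a := 0) (c := 1) (wt0_laurent wu) (wt0_laurent wv)); last exact: oner_neq0.
by rewrite mulrV // scale1r zm0.
Qed.

(** * Eigenvectors, and divisibility between linear polynomials in z_i *)

Lemma eigen_wt b (r : 'I_n -> K) : b != 0 ->
  (forall k, b * z k = r k *: (z k * b)) -> exists2 d, wt d b & forall k, r k = q k ^ d k.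
Proof.
move=> b0 bz; have [S [F [uS FP nF bE]]] := wt_graded b.
case: S uS nF bE => [|g S] uS nF bE; first by rewrite bE big_nil eqxx in b0.
(* A single nonzero component [F g] suffices: independence of weights equates its eigenvalue with
   [r k]. *)
have rE k : r k = q k ^ g k.
  have h : \sum_(d <- g :: S) (q k ^ d k - r k) *: F d = 0.
    apply: (mulrI (z_unit k)); rewrite mulr0 mulr_sumr.
    have := bz k; rewrite bE => /eqP; rewrite -subr_eq0 => /eqP e.
    rewrite -[RHS]e mulr_suml mulr_sumr scaler_sumr -sumrB; apply: eq_bigr => d _.
    by rewrite FP -scalerAr scalerBl.
  have /eqP := wt_indep uS (fun d => wtZ _ (FP d)) h (mem_head _ _).
  by rewrite scaler_eq0 (negPf (nF _ (mem_head _ _))) orbF subr_eq0 => /eqP.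
by exists g => // k; rewrite bz rE.
Qed.

Lemma lin_quot (k l : K) i h : k != 0 -> laurent h ->
  (k *: z i - 1) * h = l *: z i - 1 -> l = k /\ h = 1.
Proof.
move=> k0 lh e.
have lk : l = k.
  apply/eqP; rewrite -subr_eq0; apply/eqP.
  (* Eliminating z_i, the product (k z_i - 1) (k h - l) is the constant l - k. *)
  apply: (@lin_not_unit k i (k *: h + (- l) *: 1)) => //.
    by apply: laurentL => //; exact: laurentC.
  rewrite mulrDr -!scalerAr e mulr1 !scalerBr !scalerA mulNr [k * l]mulrC.
  by rewrite !scaleNr opprK scalerBl addrACA subrr add0r addrC.
split=> //; apply/eqP; rewrite -subr_eq0; apply/eqP.
have /loc_domain [/eqP|//] : (k *: z i - 1) * (h - 1) = 0.
  by rewrite mulrBr mulr1 e lk subrr.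
by rewrite (negPf (lin_neq0 k i)).
Qed.

(** Multiplying the equation by -l^-1 z_i turns its right side into l^-1 z_i - 1, the situation of
    [lin_quot]. *)
Lemma lin_quotV (k l : K) i h : k != 0 -> l != 0 -> laurent h ->
  (k *: z i - 1) * h = l *: (z i)^-1 - 1 -> l = k^-1 /\ h = (- l) *: (z i)^-1.
Proof.
move=> k0 l0 lh e.
have lz := laurentZ (- l^-1) (laurentM (laurent_z i) lh).
have [|lk hE] := lin_quot k0 lz (i := i) (l := l^-1).
  rewrite -scalerAr mulrA (laurent_comm (laurent_lin k i) (laurent_z i)) -mulrA e.
  rewrite mulrBr mulr1 -scalerAr mulrV ?z_unit // scalerBr scalerA mulNr mulVf //.
  by rewrite !scaleNr scale1r opprK addrC.
split; first by rewrite -lk invrK.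
apply: (mulrI (z_unit i)); rewrite -scalerAr mulrV ?z_unit // -hE scalerA.
by rewrite mulrNN mulfV // scale1r.
Qed.

Lemma gx_neq0 s i : gx s i != 0.
Proof.
apply/eqP => h; have [_ /(_ 1 laurent1)] := lreg_gx s i lreg1.
by rewrite h !mulr0 => /(_ erefl)/eqP; rewrite oner_eq0.
Qed.

Lemma monom_gx_mul (a b : G) r t i j : (zm a * gx r i) * (zm b * gx t j) =
  q i ^ (sg r * b i) *: (zm (a + b) * (gx r i * gx t j)).
Proof.
rewrite -mulrA [gx r i * _]mulrA (wt_zm _ (wt_gx r i)) chi_dl -scalerAl -scalerAr.
by rewrite zmD !mulrA.
Qed.

Lemma monom_gx_comm (a b : G) r t i j : i != j ->
  (zm a * gx r i) * (zm b * gx t j) =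
  (q i ^ (sg r * b i) / q j ^ (sg t * a j) * (if r == t then lam i j else lam j i))
    *: ((zm b * gx t j) * (zm a * gx r i)).
Proof.
move=> ij; rewrite !monom_gx_mul (gx_comm _ _ ij) -scalerAr !scalerA [b + a]addrC.
by congr (_ *: _); rewrite mulrAC divfK // expfz_neq0.
Qed.

(* The exponent of z in phi(y_i) when [m] is the one in phi(x_i). *)
Definition dual_exp (s : bool) (m : G) i : G := - m + (if s then 0 else dl i (-1)).

(* [s i] says that i is in P_1, and [m i] is the exponent of z in phi(x_i): its
   entries are the c_i, the a_ij (i in P_1) and the b_ij (i in P_2). The last
   condition also forces the entries within P_1 or within P_2 to vanish. *)
Definition aut_data (s : 'I_n -> bool) (m : 'I_n -> G) (al be : 'I_n -> K) :=
  [/\ forall i, al i != 0 /\ be i != 0,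
      forall i, al i * be i = if s i then q i ^ m i i else - q i ^ (- m i i - 1)
    & forall i j, i != j ->
        q i ^ (sg (s i) * m j i) / q j ^ (sg (s j) * m i j)
          * (if s i == s j then lam i j else lam j i) = lam i j].

Definition aut_values s m (al be : 'I_n -> K) (phi : B -> B) := forall i,
  phi (x i) = al i *: (zm (m i) * gx (s i) i) /\
  phi (y i) = be i *: (zm (dual_exp (s i) (m i) i) * gx (~~ s i) i).

(** * Images under homomorphisms *)

Section Homomorphism.
Variable phi : B -> B.
Hypothesis phi_hom : alg_hom phi.

Lemma alg_homD a b : phi (a + b) = phi a + phi b. Proof. by case: phi_hom. Qed.
Lemma alg_homZ (k : K) a : phi (k *: a) = k *: phi a. Proof. by case: phi_hom. Qed.
Lemma alg_homM a b : phi (a * b) = phi a * phi b. Proof. by case: phi_hom. Qed.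
Lemma alg_hom1 : phi 1 = 1. Proof. by case: phi_hom. Qed.
Lemma alg_homN a : phi (- a) = - phi a.
Proof. by rewrite -scaleN1r alg_homZ scaleN1r. Qed.
Lemma alg_hom0 : phi 0 = 0.
Proof. by rewrite -[in LHS](scale0r (1 : B)) alg_homZ scale0r. Qed.

Lemma alg_hom_unit u : u \is a GRing.unit -> phi u \is a GRing.unit.
Proof.
by move=> uu; apply/unitrP; exists (phi u^-1); rewrite -!alg_homM mulVr ?mulrV ?alg_hom1.
Qed.

Lemma alg_hom_gx_mulN s i :
  (q i - 1) *: (phi (gx s i) * phi (gx (~~ s) i)) = q i ^+ s *: phi (z i) - 1.
Proof. by rewrite -alg_homM -alg_homZ gx_mulN alg_homD alg_homN alg_homZ alg_hom1. Qed.

End Homomorphism.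

(** * Exponents and scalars of an automorphism *)

Section Automorphism.
Variables phi psi : B -> B.
Hypotheses (phi_hom : alg_hom phi) (psi_hom : alg_hom psi).
Hypotheses (phiK : cancel phi psi) (psiK : cancel psi phi).

Lemma aut_gx_neq0 s i : phi (gx s i) != 0.
Proof.
apply: contra_neq (gx_neq0 s i) => h.
by rewrite -[gx s i]phiK h (alg_hom0 psi_hom).
Qed.

(** Units are monomials, so [phi] and [psi] act on the z_k through integer matrices [m] and [m'].
    Comparing weights shows that [m] is diagonal with entries 1 or -1. *)
Lemma aut_sign i : exists (s : bool) (g : K), [/\ g != 0, phi (z i) = g *: z i ^ sg s
  & forall t, wt (dl i (sg (if t then s else ~~ s))) (phi (gx t i))].
Proof.
have /choice [m mP] k : exists a : G, exists2 c : K, c != 0 & phi (z k) = c *: zm a.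
  have [c [a [c0 e]]] := unit_monom (alg_hom_unit phi_hom (z_unit k)).
  by exists a, c.
have /choice [m' m'P] k : exists a : G, exists2 c : K, c != 0 & psi (z k) = c *: zm a.
  have [c [a [c0 e]]] := unit_monom (alg_hom_unit psi_hom (z_unit k)).
  by exists a, c.
(* Writing z_k as phi(psi(z_k)) shows that [phi (gx t j)] is an eigenvector, hence a weight vector.
   Its eigenvalue at z_k is a power both of q_j and of q_k, so its weight is 0 at every k other than
   j. *)
have wphi j t : wt (dl j (sg t * m' j j)) (phi (gx t j)).
  have e k : phi (gx t j) * z k = q j ^ (sg t * m' k j) *: (z k * phi (gx t j)).
    have [c c0 cE] := m'P k; rewrite -[z k]psiK -!(alg_homM phi_hom) cE.
    rewrite -scalerAr (wt_zm _ (wt_gx t j)) chi_dl -(alg_homZ phi_hom); congr (phi _).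
    by rewrite -scalerAl !scalerA mulrC.
  have [d wd dE] := eigen_wt (aut_gx_neq0 t j) e.
  suff -> : dl j (sg t * m' j j) = d by [].
  apply/ffunP => k; rewrite ffunE; have [->|kj] := eqVneq k j.
    exact: (q_expz_inj (dE j)).
  have := dE k => /(congr1 (fun a => a * (q k ^ d k)^-1)).
  rewrite mulfV ?expfz_neq0 // invr_expz => /q_expz2_eq1.
  by rewrite eq_sym kj => /(_ isT) [_ /eqP]; rewrite oppr_eq0 => /eqP.
(* The scalar in crossing phi(x_k) and phi(z_j) is found twice: by applying [phi] to the rule for
   x_k and z_j, and from the weight of phi(x_k). *)
have mE j k : m' k k * m j k = (j == k)%:Z.
  have [c c0 cE] := mP j.
  have h1 : phi (gx true k) * phi (z j) = q k ^ (j == k)%:Z *: (phi (z j) * phi (gx true k)).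
    rewrite -!(alg_homM phi_hom) (wt_gx true k j) ffunE (alg_homZ phi_hom).
    by have [->|] := eqVneq j k.
  have h2 : phi (gx true k) * phi (z j) = q k ^ (m' k k * m j k) *: (phi (z j) * phi (gx true k)).
    rewrite cE -scalerAr (wt_zm _ (wphi k true)) chi_dl mul1r -scalerAl !scalerA.
    by rewrite mulrC.
  suff : q k ^ (m' k k * m j k) = q k ^ (j == k)%:Z by move=> /q_expz_inj.
  apply/eqP; rewrite -subr_eq0.
  move/eqP: h1; rewrite h2 -subr_eq0 -scalerBl scaler_eq0 => /orP[//|].
  have zu := alg_hom_unit phi_hom (z_unit j).
  move=> /eqP/loc_domain [e|/eqP]; first by rewrite e unitr0 in zu.
  by rewrite (negPf (aut_gx_neq0 true k)).
(* [m' i i] divides 1 in the integers. *)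
have [s sE] : exists s, m' i i = sg s.
  have := mE i i; rewrite eqxx mulrC => /intUnitRing.unitzPl.
  by case/orP => /eqP ->; [exists true | exists false].
exists s; have [c c0 cE] := mP i; exists c; split=> //.
  rewrite cE -zm_dl; congr (_ *: zm _); apply/ffunP => k; rewrite ffunE.
  have [->|ki] := eqVneq k i.
    have := mE i i; rewrite eqxx sE; case: (s); rewrite /sg ?mul1r // mulN1r.
    by move=> /(canRL (@opprK _)).
  have /eqP := mE i k; rewrite [i == k]eq_sym (negPf ki) mulf_eq0 => /orP[/eqP h|/eqP //].
  by have := mE k k; rewrite h mul0r eqxx.
move=> t; have := wphi i t; rewrite sE; congr (wt (dl i _) _).
by case: t; case: (s).
Qed.

(** By weights, phi(x_i) and phi(y_i) are L-multiples of the two generators at i. Their product is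
    affine in phi(z_i), so the product of the coefficients, one of them twisted, is a quotient of
    linear polynomials in z_i or z_i^-1. Such a quotient is a monomial, and so are its factors in
    L. *)
Lemma aut_gx i : exists (s : bool) (g : K), [/\ g != 0, phi (z i) = g *: z i ^ sg s
  & forall t, exists (c : K) (a : G), c != 0 /\
      phi (gx t i) = c *: (zm a * gx (if t then s else ~~ s) i)].
Proof.
have [s [g [g0 gE gw]]] := aut_sign i; exists s, g; split=> // t.
set r := if t then s else ~~ s.
have rN : (if ~~ t then s else ~~ s) = ~~ r by rewrite /r; case: (t); case: (s).
have [f lf fE] := wt_dl_gx (gw t).
have [f1 lf1 fE1] := wt_dl_gx (gw (~~ t)); rewrite rN in fE1.
have [f' [lf' f'E _]] := laurent_twist (wt_gx r i) lf1.
have lff : laurent (f * f') by exact: laurentM.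
have e : (q i ^+ r *: z i - 1) * (f * f') = (q i ^+ t * g) *: z i ^ sg s - 1.
  rewrite -scalerA -gE -(alg_hom_gx_mulN phi_hom) fE fE1.
  rewrite -(laurent_comm lff (laurent_lin _ i)) -gx_mulN -scalerAr; congr (_ *: _).
  by rewrite -!mulrA [gx r i * (f1 * _)]mulrA f'E !mulrA.
have qr0 : q i ^+ r != 0 by rewrite expf_neq0.
have qt0 : q i ^+ t * g != 0 by rewrite mulf_neq0 ?expf_neq0.
have [c [a [c0 ffE]]] : exists (c : K) a, c != 0 /\ f * f' = c *: zm a.
  move: e; case: (s); rewrite /sg ?expr1z ?exprN1 => e.
    have [_ ->] := lin_quot qr0 lff e.
    by exists 1, 0; rewrite scale1r zm0 oner_neq0.
  have [_ ->] := lin_quotV qr0 qt0 lff e.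
  by exists (- (q i ^+ t * g)), (dl i (-1)); rewrite oppr_eq0 zm_dl exprN1.
have [c' [a' [c'0 eF]]] := laurent_unit lf lf' ffE c0; rewrite eF in fE.
by exists c', a'; split=> //; rewrite fE scalerAl.
Qed.

Lemma monom_gx_neq0 a r i : zm a * gx r i != 0.
Proof.
apply/eqP => /loc_domain [] /eqP; first by rewrite (negPf (zm_neq0 a)).
by rewrite (negPf (gx_neq0 r i)).
Qed.

Lemma aut_data_exists : exists s m al be,
  aut_data s m al be /\ aut_values s m al be phi.
Proof.
have /choice [p pP] i : exists p : bool * G * (K * K), let: (s, m, (al, be)) := p in
    [/\ al != 0 /\ be != 0,
        al * be = if s then q i ^ m i else - q i ^ (- m i - 1),
        phi (x i) = al *: (zm m * gx s i)
      & phi (y i) = be *: (zm (dual_exp s m i) * gx (~~ s) i)].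
  have [s [g [g0 gE gt]]] := aut_gx i.
  have [al [a [al0 xE]]] := gt true; have [be [b [be0 yE]]] := gt false.
  rewrite /= in xE yE; exists (s, a, (al, be)) => /=.
  set k := al * be * q i ^ (sg (~~ s) * a i).
  have k0 : k != 0 by rewrite !mulf_neq0 ?expfz_neq0.
  have lk : laurent (k *: zm (b + a)) by exact: laurent_zm.
  (* This is [phi] of the affine formula for y_i x_i; dividing by the linear factor determines both
     the exponent [b + a] and the scalar [k]. *)
  have e : (q i ^+ (~~ s) *: z i - 1) * (k *: zm (b + a)) = g *: z i ^ sg s - 1.
    have := alg_hom_gx_mulN phi_hom false i; rewrite /= xE yE scale1r gE => <-.
    rewrite -[in RHS]scalerAl -[in RHS]scalerAr monom_gx_mul !scalerA.
    rewrite -(laurent_comm lk (laurent_lin _ i)).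
    have := gx_mulN (~~ s) i; rewrite negbK => <-.
    rewrite -scalerAr -scalerAl scalerA; congr (_ *: _).
    by rewrite /k; ring.
  have [abE kE] : b = dual_exp s a i /\ al * be = if s then q i ^ a i else - q i ^ (- a i - 1).
    have q0 : q i ^+ (~~ s) != 0 by rewrite expf_neq0.
    move: lk q0 k0 e; rewrite /dual_exp /k /sg; case: (s) => /= lk q0 k0 e.
      rewrite expr1z in e.
      have [_] := lin_quot q0 lk e; rewrite -zm0 -[zm 0]scale1r => /(zm_inj k0) [ba kE].
      split; first by rewrite addr0; apply/eqP; rewrite -addr_eq0 ba.
      move: kE; rewrite mulN1r => /(congr1 (fun c => c * q i ^ a i)).
      by rewrite mul1r -[_ * _ * q i ^ a i]mulrA -expfzDr // addNr expr0z mulr1.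
    rewrite exprN1 in e; have [gE'] := lin_quotV q0 g0 lk e.
    rewrite expr1 in gE'; rewrite -exprN1 -zm_dl => /(zm_inj k0) [ba kE].
    split; first by rewrite -ba addrC addrK.
    move: kE; rewrite mul1r gE' => /(congr1 (fun c => c * q i ^ (- a i))).
    rewrite -[_ * _ * q i ^ (- a i)]mulrA -expfzDr // addrN expr0z mulr1.
    by rewrite mulNr -exprN1 -expfzDr // addrC.
  by split=> //; rewrite -abE.
exists (fun i => (p i).1.1), (fun i => (p i).1.2), (fun i => (p i).2.1), (fun i => (p i).2.2).
have {}pP i : let s := (p i).1.1 in let m := (p i).1.2 in
    let al := (p i).2.1 in let be := (p i).2.2 in
    [/\ al != 0 /\ be != 0,
        al * be = if s then q i ^ m i else - q i ^ (- m i - 1),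
        phi (x i) = al *: (zm m * gx s i)
      & phi (y i) = be *: (zm (dual_exp s m i) * gx (~~ s) i)].
  by move: (pP i); case: (p i) => [[s m] [al be]].
split; last by move=> i; case: (pP i).
split=> [i|i|i j ij]; [by case: (pP i) | by case: (pP i) |].
have [[ai0 _] _ xi _] := pP i; have [[aj0 _] _ xj _] := pP j.
(* Applying [phi] to x_i x_j = lambda_ij x_j x_i makes both sides multiples of one nonzero element,
   so the scalars agree. *)
have := congr1 phi (gx_comm true true ij); rewrite (alg_homZ phi_hom) !(alg_homM phi_hom) xi xj /=.
rewrite -!scalerAl -!scalerAr !scalerA (monom_gx_comm _ _ _ _ ij) scalerA.
move=> /eqP; rewrite -subr_eq0 -scalerBl scaler_eq0 => /orP[|/eqP/loc_domain []/eqP].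
- move=> /eqP e; apply/eqP; rewrite -subr_eq0; apply/eqP.
  by apply: (mulfI (mulf_neq0 ai0 aj0)); rewrite mulr0 -[RHS]e; ring.
- by rewrite (negPf (monom_gx_neq0 _ _ _)).
- by rewrite (negPf (monom_gx_neq0 _ _ _)).
Qed.

End Automorphism.

(** * From exponent data to automorphisms *)

Lemma data_mul (s : bool) (m : G) (al be : K) i :
  al * be = (if s then q i ^ m i else - q i ^ (- m i - 1)) ->
  let X := al *: (zm m * gx s i) in
  let Y := be *: (zm (dual_exp s m i) * gx (~~ s) i) in
  X * Y = (if s then x i * y i else - ((z i)^-1 * (y i * x i))) /\
  Y * X = (if s then y i * x i else - (q i)^-1 *: ((z i)^-1 * (x i * y i))).
Proof.
move=> abE X Y; rewrite /X /Y -!scalerAl -!scalerAr !monom_gx_mul !scalerA.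
rewrite [be * al]mulrC abE !ffunE /dual_exp [- m + _ + m]addrC !addrA !addrN !add0r.
case: s {X Y abE}; rewrite /sg /=.
  rewrite zm0 !mul1r ffunE addr0 mulN1r -expfzDr // addrN expr0z !scale1r.
  by split.
rewrite ffunE eqxx zm_dl exprN1 !mulN1r opprD !opprK mul1r; split.
  by rewrite mulNr -expfzDr // addrACA addNr addNr expr0z scaleN1r.
congr (_ *: _); rewrite mulNr -expfzDr // addrAC addNr add0r.
by rewrite exprN1.
Qed.

(** For [s] false the products are -z_i^-1 y_i x_i and -q_i^-1 z_i^-1 x_i y_i, so the identities
    reduce to the definition of z_i and to the defining relation. *)
Lemma data_rel (s : bool) (m : G) (al be : K) i :
  al * be = (if s then q i ^ m i else - q i ^ (- m i - 1)) ->
  let X := al *: (zm m * gx s i) in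
  let Y := be *: (zm (dual_exp s m i) * gx (~~ s) i) in
  X * Y - q i *: (Y * X) = 1 /\
  X * Y - Y * X = (if s then 1 else (q i)^-1) *: z i ^ sg s.
Proof.
move=> /data_mul [XY YX] X Y; rewrite XY YX {X Y XY YX}.
have [[_ /(_ i) rel] _ _ _] := hB.
case: s; first by rewrite rel scale1r expr1z zE /zel.
split.
  rewrite scalerA mulrN mulfV // scaleN1r opprK addrC -mulrBr.
  by rewrite -[x i * y i - _]/(zel x y i) -zE mulVr ?z_unit.
rewrite scaleNr opprK addrC exprN1; apply: (scalerI (hq i)).
by rewrite scalerBr !scalerA mulfV // !scale1r scalerAr -mulrBr rel mulr1.
Qed.

(** Away from its own index, the exponent in phi(y_i) is minus that in phi(x_i), so all four
    commutation rules come from the one condition in [aut_data] or from its inverse [CV]. *)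
Lemma data_comm s m al be (t u : bool) i j : aut_data s m al be -> i != j ->
  let X v k := (if v then al k else be k) *:
    (zm (if v then m k else dual_exp (s k) (m k) k) * gx (if v then s k else ~~ s k) k) in
  X t i * X u j = (if t == u then lam i j else lam j i) *: (X u j * X t i).
Proof.
move=> [_ _ /(_ i j)] C ij X; have {}C := C ij; have ji : j != i by rewrite eq_sym.
rewrite /X -!scalerAl -!scalerAr !scalerA (monom_gx_comm _ _ _ _ ij) scalerA.
have CV : (q i ^ (sg (s i) * m j i))^-1 / (q j ^ (sg (s j) * m i j))^-1
    * (if s i == s j then lam j i else lam i j) = lam j i.
  have := congr1 GRing.inv C; rewrite !invfM -(hlamV j i) => e; rewrite -[RHS]e.
  by congr (_ * _); case: ifP => _; rewrite hlamV.
have dE a b : a != b -> dual_exp (s a) (m a) a b = - m a b.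
  move=> ab; rewrite !ffunE; case: (s a); rewrite !ffunE ?addr0 // eq_sym (negPf ab).
  by rewrite addr0.
set r := (_ / _ * _ : K); suff -> : r = if t == u then lam i j else lam j i.
  by congr (_ *: _); ring.
rewrite /r {r}; case: t; case: u;
  rewrite /= ?dE // ?sgN ?mulrN ?mulNr ?mulrN ?opprK -?invr_expz -?[RHS]C -?[RHS]CV //;
  by congr (_ * _); case: (s i); case: (s j).
Qed.

Lemma aut_hom_exists s m al be : aut_data s m al be ->
  exists phi : B -> B, alg_hom phi /\ aut_values s m al be phi.
Proof.
move=> D; have [D0 D1 _] := D; have [_ _ ex _] := hB.
case: (ex B (fun i => al i *: (zm (m i) * gx (s i) i))
  (fun i => be i *: (zm (dual_exp (s i) (m i) i) * gx (~~ s i) i))).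
- split=> [i j ij|i]; last by case: (data_rel (D1 i)).
  have ne : i != j by rewrite neq_ltn ij.
  have ne' : j != i by rewrite eq_sym.
  by split; [exact: (data_comm true true D ne) | exact: (data_comm false false D ne')
    | exact: (data_comm true false D ne) | exact: (data_comm true false D ne')].
- move=> i; rewrite /zel (data_rel (D1 i)).2.
  set c := if s i then 1 else (q i)^-1.
  have c0 : c != 0 by rewrite /c; case: (s i); rewrite ?oner_neq0 ?invr_eq0.
  exists (c^-1 *: z i ^ (- sg (s i))).
  rewrite -!scalerAl -!scalerAr !scalerA mulVf // mulfV // !scale1r.
  by rewrite -!exprzDr ?z_unit // addrN addNr expr0z.
- by move=> f [fh fv]; exists f.
Qed.

Lemma values_z s m al be phi i : aut_data s m al be -> alg_hom phi ->
  aut_values s m al be phi ->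
  phi (z i) = (if s i then 1 else (q i)^-1) *: z i ^ sg (s i).
Proof.
move=> [_ D1 _] h v; rewrite [in LHS]zE /zel (alg_homD h) (alg_homN h).
rewrite !(alg_homM h) !(v i).1 !(v i).2.
exact: (data_rel (D1 i)).2.
Qed.

Definition sgexp (s : 'I_n -> bool) (a : G) : G := [ffun j => sg (s j) * a j].

(** The exponents with this property form a subgroup of Z^n containing the unit vectors. *)
Lemma values_zm s m al be phi a : aut_data s m al be -> alg_hom phi ->
  aut_values s m al be phi ->
  exists2 c : K, c != 0 & phi (zm a) = c *: zm (sgexp s a).
Proof.
move=> D h v; pose P a := exists2 c : K, c != 0 & phi (zm a) = c *: zm (sgexp s a).
have P0 : P 0.
  exists 1; rewrite ?oner_neq0 // zm0 (alg_hom1 h) scale1r.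
  by have -> : sgexp s 0 = 0 by [apply/ffunP => j; rewrite !ffunE mulr0]; rewrite zm0.
have PD a1 a2 : P a1 -> P a2 -> P (a1 + a2).
  move=> [c c0 e] [c' c'0 e']; exists (c * c'); first by rewrite mulf_neq0.
  rewrite zmD (alg_homM h) e e' -scalerAl -scalerAr scalerA -zmD; congr (_ *: zm _).
  by apply/ffunP => j; rewrite !ffunE mulrDr.
have PN a1 : P a1 -> P (- a1).
  move=> [c c0 e]; exists c^-1; rewrite ?invr_eq0 //.
  have -> : sgexp s (- a1) = - sgexp s a1 by apply/ffunP => j; rewrite !ffunE mulrN.
  have e1 := congr1 phi (zmNl a1); rewrite (alg_homM h) e (alg_hom1 h) -scalerAr in e1.
  by rewrite -[zm (- sgexp s a1)]mul1r -e1 -scalerAl scalerA mulVf // scale1r -mulrA zmNr mulr1.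
have Pdl j : P (dl j 1).
  exists (if s j then 1 else (q j)^-1).
    by case: (s j); rewrite ?oner_neq0 ?invr_eq0.
  rewrite zm_dl expr1z (values_z j D h v); congr (_ *: _); rewrite -zm_dl; congr zm.
  by apply/ffunP => k; rewrite !ffunE; case: eqP => [->|]; rewrite ?mulr1 ?mulr0.
have Pn j (k : nat) : P (dl j k%:Z).
  elim: k => [|k IH].
    by have -> : dl j 0 = 0 by apply/ffunP => k; rewrite !ffunE; case: eqP.
  have -> : dl j k.+1%:Z = dl j k%:Z + dl j 1; last exact: PD.
  by apply/ffunP => l; rewrite !ffunE -addn1 PoszD; case: eqP => _; rewrite ?addr0.
have Pz j (k : int) : P (dl j k).
  case: k => k; first exact: Pn.
  have -> : dl j (Negz k) = - dl j k.+1%:Z; last exact/PN/Pn.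
  by apply/ffunP => l; rewrite !ffunE NegzE; case: eqP => _; rewrite ?oppr0.
by rewrite -/(P _) (sum_dl a); elim/big_rec: _ => // i b _; exact: PD.
Qed.

(** The inverse keeps the partition, and [m'] is chosen so that [phi] sends [zm (m' i) * gx (s i) i]
    to a multiple of x_i. The scalar [al'] normalises this multiple, and the product condition
    dictates the scalar for y_i. *)
Lemma aut_data_right_inverse s m al be phi : aut_data s m al be -> alg_hom phi ->
  aut_values s m al be phi -> exists m' al' be', aut_data s m' al' be' /\
    forall psi, alg_hom psi -> aut_values s m' al' be' psi -> cancel psi phi.
Proof.
move=> D h v; have [D0 D1 D2] := D.
(* Outside P_1 it is phi(y_i), not phi(x_i), that is a multiple of x_i. *)
pose e i := if s i then m i else dual_exp (s i) (m i) i.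
have eE i : exists2 A : K, A != 0 & phi (gx (s i) i) = A *: (zm (e i) * x i).
  have [a0 b0] := D0 i; have [vx vy] := v i; rewrite /e.
  by case: (s i) vx vy => vx vy; [exists (al i) | exists (be i)].
have e_off i j : i != j -> e i j = sg (s i) * m i j.
  move=> ij; rewrite /e; case: (s i); rewrite ?mul1r // mulN1r !ffunE eq_sym.
  by rewrite (negPf ij) addr0.
pose m' i := - sgexp s (e i).
have m'E i : sgexp s (m' i) = - e i.
  apply/ffunP => j; rewrite !ffunE mulrN mulrA.
  by have -> : sg (s j) * sg (s j) = 1 by [case: (s j)]; rewrite mul1r.
have /choice [al' al'P] i : exists c : K, c != 0 /\
    phi (c *: (zm (m' i) * gx (s i) i)) = x i.
  have [A A0 AE] := eE i; have [C C0 CE] := values_zm (m' i) D h v.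
  exists (A * C)^-1; split; first by rewrite invr_eq0 mulf_neq0.
  rewrite (alg_homZ h) (alg_homM h) AE CE m'E -scalerAl -scalerAr !scalerA mulrA zmNl mul1r.
  by rewrite -mulrA [C * A]mulrC mulVf ?mulf_neq0 // scale1r.
pose w i : K := if s i then q i ^ m' i i else - q i ^ (- m' i i - 1).
have w0 i : w i != 0 by rewrite /w; case: (s i); rewrite ?oppr_eq0 expfz_neq0.
exists m', al', (fun i => w i / al' i).
have D' : aut_data s m' al' (fun i => w i / al' i).
  split=> [i|i|i j ij].
  - by have [a0 _] := al'P i; rewrite a0 mulf_neq0 ?invr_eq0.
  - by have [a0 _] := al'P i; rewrite mulrC divfK.
  have ji : j != i by rewrite eq_sym.
  have C := D2 i j ij; rewrite !ffunE !e_off // !mulrN !mulrA.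
  have sq b : sg b * sg b = 1 by case: b.
  rewrite !sq !mul1r; set l := lam i j in C *.
  (* Passing to [m'] keeps the exponents of the condition when i and j are on opposite sides and
     negates them on the same side, which is harmless as the quotient of powers is then 1. *)
  have rev (a b : int) : q i ^ a / q j ^ b * l = l -> q i ^ (- a) / q j ^ (- b) * l = l.
    move=> e0; have /mulIf e1 : l != 0 by exact: hlam0.
    have {e0 e1}/divr1_eq e2 : q i ^ a / q j ^ b = 1 by apply: e1; rewrite e0 mul1r.
    by rewrite -!invr_expz e2 divff ?mul1r // invr_eq0 expfz_neq0.
  move: C; case: (s i); case: (s j); rewrite /= ?mul1r ?mulN1r ?opprK //.
  - exact: rev.
  - by move/rev; rewrite !opprK.
split=> // psi g u b.
have phx i : phi (psi (x i)) = x i by rewrite (u i).1 (al'P i).2.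
have phz i : phi (psi (z i)) = z i.
  rewrite (values_z i D' g u) (alg_homZ h); case: (boolP (s i)) => si.
    by rewrite expr1z scale1r (values_z i D h v) si scale1r expr1z.
  have zV : phi (z i)^-1 * phi (z i) = 1 by rewrite -(alg_homM h) mulVr ?z_unit ?(alg_hom1 h).
  have := values_z i D h v; rewrite (negPf si) /sg exprN1 => zE'.
  rewrite -[phi _^-1]mulr1 -(mulVr (z_unit i)) mulrA scalerAl.
  by rewrite [_^-1 *: (_ * _)]scalerAr -zE' zV mul1r.
(* The composite fixes x_i and z_i, hence y_i x_i, and x_i cancels in a domain. *)
have phy i : phi (psi (y i)) = y i.
  have e1 := congr1 phi (alg_hom_gx_mulN g false i).
  rewrite /= scale1r (alg_homZ h) (alg_homM h) (alg_homD h) (alg_homN h) (alg_hom1 h) phx phz in e1.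
  have e2 := gx_mulN false i; rewrite /= scale1r -e1 in e2.
  apply/eqP; rewrite -subr_eq0; apply/eqP.
  have q10 : q i - 1 != 0 by rewrite subr_eq0 q_neq1.
  have /loc_domain [//|/eqP] : (phi (psi (y i)) - y i) * x i = 0.
    by rewrite mulrBl; apply/eqP; rewrite subr_eq0; apply/eqP/(scalerI q10).
  by rewrite (negPf (gx_neq0 true i)).
have [_ _ _ uniq] := hB.
apply: (uniq B (phi \o psi) id) => [||i] /=; last by rewrite phx phy.
- have [gD gZ gM g1] := g; have [hD hZ hM h1] := h.
  by split=> * /=; rewrite ?gD ?gZ ?gM ?g1 ?hD ?hZ ?hM ?h1.
- by split.
Qed.

(** The right inverse [psi] of [phi] is again given by data and so has a right inverse itself; the
    two one-sided inverses of [psi] coincide. *)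
Lemma aut_of_data s m al be : aut_data s m al be ->
  exists phi : B -> B, alg_aut phi /\ aut_values s m al be phi.
Proof.
move=> D; have [phi [h v]] := aut_hom_exists D; exists phi; split=> //; split=> //.
have [m1 [al1 [be1 [D1 K1]]]] := aut_data_right_inverse D h v.
have [psi [h1 v1]] := aut_hom_exists D1.
have [m2 [al2 [be2 [D2 K2]]]] := aut_data_right_inverse D1 h1 v1.
have [chi' [h2 v2]] := aut_hom_exists D2.
have c1 := K1 _ h1 v1; have c2 := K2 _ h2 v2.
by exists psi => // b; rewrite -{1}(c2 b) c1 c2.
Qed.

Lemma aut_has_data phi : alg_aut phi -> exists s m al be,
  aut_data s m al be /\ aut_values s m al be phi.
Proof.
move=> [h [psi phiK psiK]].
have g : alg_hom psi.
  have [hD hZ hM h1] := h.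
  split=> [a b|k a|a b|]; apply: (can_inj phiK); rewrite ?hD ?hZ ?hM ?h1 !psiK //.
exact: (aut_data_exists h g phiK psiK).
Qed.

(** * Translation to products over the two sides of the partition *)

Lemma zm_split (D : {set 'I_n}) i (a : G) : i \notin D ->
  (forall j, j \notin D -> j != i -> a j = 0) ->
  zm a = (\prod_(j in D) zel x y j ^ a j) * zel x y i ^ a i.
Proof.
move=> iD a0; rewrite -zE -zm_dl.
have -> : \prod_(j in D) zel x y j ^ a j = zm [ffun j => if j \in D then a j else 0].
  rewrite /zm big_mkcond; apply: eq_bigr => j _; rewrite ffunE -zE.
  by case: ifP; rewrite ?expr0z.
rewrite -zmD; congr zm; apply/ffunP => j; rewrite !ffunE.
have [->|ji] := eqVneq j i; first by rewrite (negPf iD) add0r.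
by rewrite addr0; case: ifP => // /negbT jD; exact: a0.
Qed.

(** Exponents vanish on the side of i except at i, leaving the opposite side [D] and one power of
    z_i; the extra -1 of [dual_exp] outside P_1 joins that power. *)
Lemma zm_split_sides (P1 : {set 'I_n}) i (m : G) :
  (forall j, j != i -> (j \in P1) = (i \in P1) -> m j = 0) ->
  let D := if i \in P1 then ~: P1 else P1 in
  zm m = (\prod_(j in D) zel x y j ^ m j) * zel x y i ^ m i /\
  zm (dual_exp (i \in P1) m i) = (\prod_(j in D) zel x y j ^ (- m j))
    * zel x y i ^ (if i \in P1 then - m i else - m i - 1).
Proof.
move=> m0 D.
have iD : i \notin D by rewrite /D; case: ifP => [|/negbT //]; rewrite inE negbK.
have DP j : (j \notin D) = ((j \in P1) == (i \in P1)).
  by rewrite /D; case: (i \in P1); rewrite ?inE ?negbK; case: (j \in P1).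
split; first by apply: zm_split => // j; rewrite DP => /eqP e ji; exact: m0.
have dE j : dual_exp (i \in P1) m i j =
    - m j + (if (j == i) && (i \notin P1) then -1 else 0).
  rewrite !ffunE; case: (i \in P1); rewrite !ffunE ?andbF // andbT.
  by case: eqP.
rewrite (zm_split iD) => [|j]; last first.
  by rewrite DP dE => /eqP e ji; rewrite m0 // (negPf ji) oppr0.
rewrite dE eqxx; congr (_ * _); last by case: (i \in P1); rewrite ?addr0.
apply: eq_bigr => j jD; rewrite dE; case: eqP => [ji|_]; last by rewrite addr0.
by rewrite -ji jD in iD.
Qed.

(** On one side lambda_ij cancels from the condition, leaving powers of q_i and q_j with product 1;
    independence makes both exponents 0. *)
Lemma aut_data_same_side s m al be i j : aut_data s m al be -> i != j ->
  s i = s j -> m i j = 0.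
Proof.
move=> [_ _ /(_ i j)] D ij sij; have := D ij.
rewrite sij eqxx => /(canRL (mulfK (hlam0 i j))); rewrite divff // invr_expz.
move=> /(q_expz2_eq1 ij) [_ /eqP]; rewrite oppr_eq0 mulf_eq0.
by case: (s j) => /= /eqP.
Qed.

End QuantumWeyl.

Theorem theorem3p2 (K : fieldType) (n : nat) (q : 'I_n -> K)
    (lam : 'I_n -> 'I_n -> K)
    (hn : (0 < n)%N)
    (hq : forall i, q i != 0)
    (hlam0 : forall i j, lam i j != 0)
    (hlamV : forall i j, lam i j = (lam j i)^-1)
    (hlam1 : forall i, lam i i = 1)
    (hgen : forall e : 'I_n -> int, \prod_(k < n) q k ^ e k = 1 -> forall k, e k = 0)
    (B : unitAlgType K) (x y : 'I_n -> B)
    (hB : is_loc_qweyl q lam x y) :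
  let z := zel x y in
  (forall phi : B -> B, alg_aut phi ->
     exists (P1 : {set 'I_n}) (c : 'I_n -> int) (a b : 'I_n -> 'I_n -> int)
            (alpha beta : 'I_n -> K),
       [/\ forall k, alpha k != 0 /\ beta k != 0,
           forall i, i \in P1 ->
             [/\ phi (x i) = alpha i *: ((\prod_(j in ~: P1) z j ^ a i j) * z i ^ c i * x i),
                 phi (y i) = beta i *: ((\prod_(j in ~: P1) z j ^ (- a i j)) * z i ^ (- c i) * y i)
               & alpha i * beta i = q i ^ c i],
           forall j, j \notin P1 ->
             [/\ phi (x j) = alpha j *: ((\prod_(i in P1) z i ^ b j i) * z j ^ c j * y j),
                 phi (y j) = beta j *: ((\prod_(i in P1) z i ^ (- b j i)) * z j ^ (- c j - 1) * x j)
               & alpha j * beta j = - q j ^ (- c j - 1)]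
         & forall i j, i \in P1 -> j \notin P1 -> q i ^ b j i * q j ^ a i j = lam i j ^+ 2]) /\
  (forall (P1 : {set 'I_n}) (c : 'I_n -> int) (a b : 'I_n -> 'I_n -> int)
          (alpha beta : 'I_n -> K),
     (forall k, alpha k != 0 /\ beta k != 0) ->
     (forall i, i \in P1 -> alpha i * beta i = q i ^ c i) ->
     (forall j, j \notin P1 -> alpha j * beta j = - q j ^ (- c j - 1)) ->
     (forall i j, i \in P1 -> j \notin P1 -> q i ^ b j i * q j ^ a i j = lam i j ^+ 2) ->
     exists phi : B -> B, alg_aut phi /\
       (forall i, i \in P1 ->
          phi (x i) = alpha i *: ((\prod_(j in ~: P1) z j ^ a i j) * z i ^ c i * x i) /\
          phi (y i) = beta i *: ((\prod_(j in ~: P1) z j ^ (- a i j)) * z i ^ (- c i) * y i)) /\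
       (forall j, j \notin P1 ->
          phi (x j) = alpha j *: ((\prod_(i in P1) z i ^ b j i) * z j ^ c j * y j) /\
          phi (y j) = beta j *: ((\prod_(i in P1) z i ^ (- b j i)) * z j ^ (- c j - 1) * x j))).
Proof.
split.
  move=> phi /(aut_has_data hq hlam0 hlamV hgen hB) [s [m [al [be [D v]]]]].
  have [D0 D1 D2] := D; pose P1 := [set i | s i].
  have sP i : (i \in P1) = s i by rewrite inE.
  have m0 i j : j != i -> (j \in P1) = (i \in P1) -> m i j = 0.
    rewrite !sP => ji sij; apply: (aut_data_same_side hlam0 hgen D) => //.
    by rewrite eq_sym.
  (* [m] serves both as [a] and as [b], which read disjoint sets of its entries. *)
  exists P1, (fun i => m i i), m, m, al, be; split=> //.
  - move=> i iP; have [vx vy] := v i; have [e1 e2] := zm_split_sides hq hlam0 hlamV hB (m0 i).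
    have si : s i by rewrite -sP.
    by rewrite iP in e1 e2; rewrite vx vy si e1 e2 D1 si; split.
  - move=> i iP; have [vx vy] := v i; have [e1 e2] := zm_split_sides hq hlam0 hlamV hB (m0 i).
    have si : s i = false by rewrite -sP (negPf iP).
    by rewrite (negPf iP) in e1 e2; rewrite vx vy si e1 e2 D1 si; split.
  - move=> i j; rewrite !sP => si /negPf sj.
    have ij : i != j by apply: contraFneq sj => <-.
    (* On opposite sides the condition reads q_i^(b_ji) q_j^(a_ij) / lambda_ij = lambda_ij. *)
    have := D2 i j ij; rewrite si sj /= mul1r mulN1r -invr_expz invrK [lam j i]hlamV.
    by move/(canRL (divfK (hlam0 i j))).
move=> P1 c a b al be D0 D1 D2 D3.
(* Entries within one side are set to 0, as the condition demands there. *)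
pose m i : {ffun 'I_n -> int} := [ffun j => if j == i then c i else
  if (i \in P1) == (j \in P1) then 0 else if i \in P1 then a i j else b i j].
have m0 i j : j != i -> (j \in P1) = (i \in P1) -> m i j = 0.
  by move=> ji e; rewrite ffunE (negPf ji) e eqxx.
have mi i : m i i = c i by rewrite ffunE eqxx.
have ma i j : i \in P1 -> j \in ~: P1 -> m i j = a i j.
  rewrite inE ffunE => iP jP; rewrite iP (negPf jP) /=.
  by case: eqP => // ji; rewrite ji iP in jP.
have mb i j : i \notin P1 -> j \in P1 -> m i j = b i j.
  rewrite ffunE => iP jP; rewrite jP (negPf iP) /=.
  by case: eqP => // ji; rewrite -ji jP in iP.
have D : aut_data q lam (fun i => i \in P1) m al be.
  split=> // [i|i j ij].
    by rewrite mi; case: ifP => [/D1|/negbT/D2].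
  have ji : j != i by rewrite eq_sym.
  have [iP|iP] := boolP (i \in P1); have [jP|jP] := boolP (j \in P1); rewrite /=.
  - by rewrite !m0 ?iP ?jP // !mulr0 !expr0z divr1 mul1r.
  - rewrite mul1r mulN1r -invr_expz invrK mb // ma ?inE // D3 // [lam j i]hlamV.
    by rewrite expr2 mulfK.
  (* With i and j exchanged, the hypothesis enters through its inverse. *)
  - rewrite mul1r mulN1r ma ?inE // mb // -invr_expz -invfM [_ * q j ^ _]mulrC D3 //.
    by rewrite expr2 invfM divfK // -hlamV.
  - by rewrite !m0 ?(negPf iP) ?(negPf jP) // !mulr0 !expr0z divr1 mul1r.
have [phi [aut v]] := aut_of_data hq hlam0 hlamV hgen hB D.
exists phi; split=> //; split=> i iP; have [vx vy] := v i;
  have [e1 e2] := zm_split_sides hq hlam0 hlamV hB (m0 i).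
  rewrite iP mi in e1 e2; rewrite vx vy iP e1 e2.
  by split; congr (_ *: (_ * _ * _)); apply: eq_bigr => j jP; rewrite ma.
rewrite (negPf iP) mi in e1 e2; rewrite vx vy (negPf iP) e1 e2.
by split; congr (_ *: (_ * _ * _)); apply: eq_bigr => j jP; rewrite mb.
Qed.
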